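(* Let $G \subset \mathbb{T}$ be finite and let $\Omega$ be the set of edges of $\mathbb{H}$ bordering a hexagon in $G$. Then, for any $\tau\in \{-1,1\}^{\mathbb{T}}$ and any $n,x>0$, if $\sigma$ has law $\mu_{G,n,x}^\tau$, then $\omega(\sigma)$ has law $\mathbb{P}_{\Omega,n,x}^{\,\omega(\tau)}$.
   Context: $\mathbb{T}$ is the triangular lattice with vertices $r+e^{i\pi/3}s$, $r,s\in\mathbb{Z}$ (nearest neighbours at distance 1), and $\mathbb{H}$ is its dual hexagonal lattice. Vertices of $\mathbb{T}$ are called hexagons and identified with faces of $\mathbb{H}$. A loop configuration is a spanning subgraph of $\mathbb{H}$ in which every vertex has even degree; a loop is a subgraph isomorphic to a (finite) cycle. For a finite set of edges $\Omega$ of $\mathbb{H}$ and a loop configuration $\xi$, $\mathcal{E}(\Omega,\xi)$ is the set of loop configurations coinciding with $\xi$ outside $\Omega$. For real $n,x>0$, the loop $O(n)$ measure is the probability measure on $\mathcal{E}(\Omega,\xi)$ given by $\mathbb{P}_{\Omega,n,x}^{\xi}(\omega)=x^{|\omega|}n^{\ell(\omega)}/Z_{\Omega,n,x}^{\xi}$, where $|\omega|$ is the number of edges of $\omega\cap\Omega$, $\ell(\omega)$ is the number of loops of $\omega$ intersecting $\Omega$, and $Z_{\Omega,n,x}^\xi$ is the normalizing constant. For $\sigma\in\{-1,1\}^{\mathbb{T}}$, $\omega(\sigma)$ is the loop configuration composed of the edges of $\mathbb{H}$ separating two hexagons $u,v$ with $\sigma_u\neq\sigma_v$. For $\tau\in\{-1,1\}^{\mathbb{T}}$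 and $G\subset\mathbb{T}$ finite, $\Sigma(G,\tau)$ is the set of spin configurations in $\{-1,1\}^{\mathbb{T}}$ coinciding with $\tau$ outside $G$, and $\mu_{G,n,x}^\tau$ is the probability measure on $\Sigma(G,\tau)$ defined by $\mu_{G,n,x}^\tau(\sigma)=n^{k(\sigma)}x^{e(\sigma)}/\mathbf{Z}_{G,n,x}^\tau$, where $k(\sigma)+1$ is the sum of the number of connected components of pluses and of minuses in $\sigma$ (connectivity in $\mathbb{T}$) that intersect $G$ or its neighborhood (the set of vertices adjacent to $G$), $e(\sigma)$ is the number of edges $\{u,v\}$ of $\mathbb{T}$ that intersect $G$ and have $\sigma_u\neq\sigma_v$, and $\mathbf{Z}_{G,n,x}^\tau$ is the normalizing constant.
   Formalization: The formal theorem additionally assumes that the complement of G in the triangular lattice is connected; without this the claim fails, e.g. for G the six neighbours of a hexagon and τ identically +1. *)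

(* Defs.v *)
From HB Require Import structures.
From mathcomp Require Import all_boot all_order all_algebra.
From mathcomp Require Import finmap.
From mathcomp Require Import all_classical all_reals all_analysis.
Set Implicit Arguments.
Unset Strict Implicit.
Unset Printing Implicit Defensive.
Import Order.TTheory GRing.Theory Num.Theory.
Local Open Scope classical_set_scope.
Local Open Scope ring_scope.

(* [card] is 0 on infinite sets; the sets counted below are finite when [G],
   resp. [Omega], is finite and [omega] is a loop configuration. *)
Definition card (T : choiceType) (A : set T) : nat := #|` fset_set A|.

Definition graph_edges (V : choiceType) (adj : rel V) : set {fset V} :=
  [set e | exists u v, adj u v /\ e = [fset u; v]%fset].

(** * The triangular lattice and its dual *)

(* (r, s) stands for the point r + e^{i pi/3} s of the plane. *)
Definition hexagon : Type := (int * int)%type.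
HB.instance Definition _ := Choice.on hexagon.

(* r^2 + rs + s^2 is the squared modulus of r + e^{i pi/3} s. *)
Definition tadj : rel hexagon := fun u v =>
  let r := v.1 - u.1 in let s := v.2 - u.2 in
  r ^+ 2 + r * s + s ^+ 2 == 1.

(* The vertices of the hexagonal lattice are the triangular faces of the
   triangular lattice, each given by its three corners: (r, s, true) is the
   upward triangle with lower left corner (r, s), and (r, s, false) is the
   downward triangle completing it to a rhombus. *)
Definition hvertex : Type := (int * int * bool)%type.
HB.instance Definition _ := Choice.on hvertex.

Definition corners (f : hvertex) : {fset hexagon} :=
  let: (r, s, up) := f in
  let r' := r + 1 in let s' := s + 1 in
  if up then [fset (r, s); (r', s); (r, s')]%fset
  else [fset (r', s); (r, s'); (r', s')]%fset.

Definition hadj : rel hvertex := fun f g =>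
  #|` (corners f `&` corners g)%fset| == 2%N.

Definition hedge : Type := {fset hvertex}.
HB.instance Definition _ := Choice.on hedge.

(* The hexagons bordered by an edge of the hexagonal lattice are the two
   endpoints of the dual edge, i.e. the two common corners of its endpoints. *)
Definition borders (e : hedge) (u : hexagon) : Prop :=
  forall f, f \in e -> u \in corners f.

Definition bordering_edges (G : set hexagon) : set hedge :=
  [set e | graph_edges hadj e /\ exists2 u, G u & borders e u].

(** * Loop configurations and the loop O(n) measure *)

(* A spanning subgraph of the hexagonal lattice is given by its set of edges. *)
Definition subgraph : Type := set hedge.
HB.instance Definition _ := Choice.on subgraph.
HB.instance Definition _ := isPointed.Build subgraph set0.

Definition loop_configuration (omega : subgraph) : Prop :=
  omega `<=` graph_edges hadj /\
  forall f : hvertex, ~~ odd (card [set e | omega e /\ f \in e]).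

Definition is_loop (C : subgraph) : Prop :=
  exists c : seq hvertex, [/\ ucycle hadj c, (2 < size c)%N &
    C = [set e | exists2 f, f \in c & e = [fset f; next c f]%fset]].

Definition loop_configs (Omega : set hedge) (xi : subgraph) : set subgraph :=
  [set omega | loop_configuration omega /\ omega `\` Omega = xi `\` Omega].

Definition num_edges (Omega : set hedge) (omega : subgraph) : nat :=
  card (omega `&` Omega).

Definition num_loops (Omega : set hedge) (omega : subgraph) : nat :=
  card [set C | [/\ is_loop C, C `<=` omega & C `&` Omega !=set0]].

(* The probability measure on the finite set [S] proportional to the weight
   [w], extended by zero outside [S]. *)
Definition weighted_law (R : realType) (T : choiceType) (S : set T)
    (w : T -> R) (A : set T) : \bar R :=
  ((\sum_(t \in S `&` A) w t) / (\sum_(t \in S) w t))%:E.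

Definition loop_measure (R : realType) (Omega : set hedge) (n x : R)
    (xi : subgraph) : set subgraph -> \bar R :=
  weighted_law (loop_configs Omega xi)
    (fun omega => x ^+ num_edges Omega omega * n ^+ num_loops Omega omega).

(** * Spin configurations *)

(* [true] is the spin +1 and [false] the spin -1. *)
Definition spin_config : Type := hexagon -> bool.
HB.instance Definition _ := Choice.on spin_config.
HB.instance Definition _ := isPointed.Build spin_config (fun=> true).

Definition loops_of (sigma : spin_config) : subgraph :=
  [set e | graph_edges hadj e /\
    exists u v, [/\ borders e u, borders e v & sigma u != sigma v]].

Definition spin_configs (G : set hexagon) (tau : spin_config) :
    set spin_config :=
  [set sigma | forall u, ~ G u -> sigma u = tau u].

Definition connected_in (A : set hexagon) (u v : hexagon) : Prop :=
  exists p : seq hexagon,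
    [/\ path tadj u p, last u p = v & forall w, w \in u :: p -> A w].

Definition connected_set (A : set hexagon) : Prop :=
  forall u v, A u -> A v -> connected_in A u v.

Definition components (A : set hexagon) : set (set hexagon) :=
  [set C | exists2 u, A u & C = [set v | connected_in A u v]].

Definition neighborhood (G : set hexagon) : set hexagon :=
  [set v | exists2 u, G u & tadj u v].

Definition num_clusters (G A : set hexagon) : nat :=
  card [set C | components A C /\ C `&` (G `|` neighborhood G) !=set0].

(* An integer, because the value is -1 when [G] is empty. *)
Definition spin_k (G : set hexagon) (sigma : spin_config) : int :=
  (num_clusters G [set u | sigma u] +
   num_clusters G [set u | ~~ sigma u])%N%:Z - 1.

Definition spin_e (G : set hexagon) (sigma : spin_config) : nat :=
  card [set e | graph_edges tadj e /\
    exists u v, [/\ u \in e, v \in e, G u & sigma u != sigma v]].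

Definition spin_measure (R : realType) (G : set hexagon) (n x : R)
    (tau : spin_config) : set spin_config -> \bar R :=
  weighted_law (spin_configs G tau)
    (fun sigma => n ^ spin_k G sigma * x ^+ spin_e G sigma).

(* [loops_of] maps [spin_configs G tau] into
   [loop_configs (bordering_edges G) (loops_of tau)]. It is onto exactly when
   the complement of the finite set [G] is connected: flipping [tau] on a hole
   of [G] alters [loops_of tau] only along [bordering_edges G], but yields a
   loop configuration that comes from no spin configuration equal to [tau]
   outside [G]. *)

(** * Measurable structures *)

(* The laws above are carried by finite sets of configurations, so both
   configuration spaces are given the discrete sigma-algebra. *)
HB.instance Definition _ := @isMeasurable.Build default_measure_display
  spin_config discrete_measurable discrete_measurable0
  discrete_measurableC discrete_measurableU.
HB.instance Definition _ := @isMeasurable.Build default_measure_display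
  subgraph discrete_measurable discrete_measurable0
  discrete_measurableC discrete_measurableU.

(* Main.v *)
(* The map [loops_of] is a bijection from [spin_configs G tau] onto
   [loop_configs Omega (loops_of tau)]: on the triangular lattice an edge
   function whose sum around every triangle is even is a coboundary, and
   connectedness of the complement of [G] fixes the global sign.  It remains to
   see that k(sigma) - l(omega(sigma)) does not depend on [sigma].

   Work in a large box B.  By the same exactness, now on B, the coboundary
   identifies the functions B -> bool constant on the clusters of sigma in B,
   up to a global flip, with the functions on the bichromatic edges of B that
   are constant along interfaces.  Counting gives #clusters = #interfaces + 1.
   An interface in B is a loop or a path with two ends, so
   2 #clusters = 2 #loops + #ends + 2.  The clusters away from G, the loops off
   Omega and the ends are common to all configurations that agree off G, and for
   B large the other clusters and loops are those counted by k and l. *)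

Require Import Defs.
From mathcomp Require Import all_boot all_order all_algebra.
From mathcomp Require Import finmap zify.
From mathcomp Require Import all_classical all_reals all_analysis.
Set Implicit Arguments.
Unset Strict Implicit.
Unset Printing Implicit Defensive.
Import Order.TTheory GRing.Theory Num.Theory.

(** * Finite graphs *)

(** Counting Boolean functions takes the place of Euler's formula and of a Jordan curve argument: a
    finite graph with m components carries 2^m locally constant functions, so the relation between
    clusters and interfaces is read off from exponents. The box is forced by infinity: in the whole
    lattice, clusters and interfaces may be infinite in size and in number. Its price is that
    exactness must hold on the box and that interfaces get cut. For the first, clamping the
    coordinates retracts the lattice onto the box and maps faces into faces, so a closed function on
    the box is pulled back to the lattice, where a potential is an explicit sum. For the second,
    every cut leaves an end in a face that sticks out of the box, and such a face has no corner in
    [G] once the box contains [G] and its neighborhood; the identity is kept doubled so that ends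
    can be counted without halving. The size of the box is chosen only after the two configurations
    to be compared. *)

Definition locally_constant (V : finType) (e : rel V) :=
  [set f : {ffun V -> bool} | [forall x, forall y, e x y ==> (f x == f y)]].

Lemma locally_constantP (V : finType) (e : rel V) (f : {ffun V -> bool}) :
  reflect (forall x y, e x y -> f x = f y) (f \in locally_constant e).
Proof.
rewrite inE; apply: (iffP forallP) => [H x y exy|H x].
  by apply/eqP; move: (H x) => /forallP/(_ y)/implyP; exact.
by apply/forallP => y; apply/implyP => /H ->.
Qed.

(** The values at the roots of the components can be prescribed freely and determine the
    function. *)
Lemma card_locally_constant (V : finType) (e : rel V) : connect_sym e ->
  #|locally_constant e| = 2 ^ n_comp e predT.
Proof.
move=> esym.
pose Rt := {x : V | roots e x}.
pose phi (f : {ffun V -> bool}) : {ffun Rt -> bool} := [ffun r => f (val r)].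
set A := locally_constant e.
have constA f : f \in A -> forall x y, connect e x y -> f x = f y.
  move=> /locally_constantP fA x y /connectP[p + ->].
  by elim: p x => //= z p IHp x /andP[exz /IHp <-]; exact: fA.
have phiK : phi @: A = [set: {ffun Rt -> bool}].
  apply/setP => g; rewrite [in RHS]inE; apply/imsetP.
  exists [ffun x => g (Sub (fingraph.root e x) (roots_root esym x))].
    apply/locally_constantP => x y exy; rewrite !ffunE; congr (g _); apply: val_inj => /=.
    by apply/eqP; rewrite root_connect // connect1.
  apply/ffunP => r; rewrite !ffunE; congr (g _); apply: val_inj => /=.
  by have /eqP := valP r.
have phi_inj : {in A &, injective phi}.
  move=> f f' fA f'A /ffunP fE; apply/ffunP => x.
  rewrite (constA f fA x _ (connect_root e x)).
  rewrite (constA f' f'A x _ (connect_root e x)).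
  by move: (fE (Sub (fingraph.root e x) (roots_root esym x))); rewrite !ffunE.
rewrite -(card_in_imset phi_inj) phiK cardsT card_ffun card_bool; congr (_ ^ _).
rewrite card_sig; apply: eq_card => x.
by rewrite !inE andbT.
Qed.

(** * Graphs of maximal degree two *)

Section DegreeTwo.
Variables (W : finType) (e : rel W).
Hypotheses (esym : symmetric e) (eirr : irreflexive e).
Hypothesis deg_le2 : forall x, #|e x| <= 2.

Lemma deg_le2P x a b c : e x a -> e x b -> e x c -> a != b -> c \in [:: a; b].
Proof.
move=> xa xb xc ab; apply: contraT => cab.
suff : 2 < #|e x| by rewrite ltnNge deg_le2.
have u : uniq [:: c; a; b] by rewrite /= cab andbT !inE ab.
apply: (@leq_trans #|[:: c; a; b]|); first by rewrite (card_uniqP u).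
apply/subset_leq_card/fintype.subsetP => y.
by rewrite !inE => /or3P[] /eqP->; rewrite unfold_in.
Qed.

Lemma extend_path x p : path e x p -> uniq (x :: p) ->
  exists q, [/\ path e x (p ++ q), uniq (x :: p ++ q) &
    forall y, e (last x (p ++ q)) y -> y \in x :: p ++ q].
Proof.
move: {2}(#|W| - size p) (leqnn (#|W| - size p)) => n.
elim: n p => [|n IHn] p szp px up.
  have := card_size (x :: p); rewrite (card_uniqP up) => _.
  exists [::]; rewrite cats0; split=> // y _.
  have : size (x :: p) <= #|W| by rewrite -(card_uniqP up) max_card.
  by move: szp; rewrite leqn0 subn_eq0 /= => h1 h2; have := leq_trans h2 h1; rewrite ltnn.
have [/existsP[y /andP[ey yp]]|/existsPn h] :=
  boolP [exists y, e (last x p) y && (y \notin x :: p)].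
  have [|||q [pq uq hq]] := IHn (rcons p y); rewrite ?size_rcons.
  - have : size (x :: p) <= #|W| by rewrite -(card_uniqP up) max_card.
    by move: szp; rewrite leq_subLR addnS -addSn -leq_subLR subnS => + _; case: (#|W| - _).
  - by rewrite rcons_path px.
  - by rewrite -rcons_cons rcons_uniq yp.
  by exists (y :: q); rewrite -cat_rcons.
exists [::]; rewrite cats0; split=> // y ey.
by have := h y; rewrite ey negbK.
Qed.

(** Extend from [x], reverse the path, extend again. The first end stays saturated because the
    second extension only adds vertices. *)
Lemma maximal_path x : exists y p,
  [/\ path e y p, uniq (y :: p), x \in y :: p,
      forall z, e y z -> z \in y :: p & forall z, e (last y p) z -> z \in y :: p].
Proof.
have [q [/= pq uq hq]] := @extend_path x [::] isT isT.
set y := last x q in hq.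
pose r := rev (belast x q).
have rE : y :: r = rev (x :: q) by rewrite [x :: q]lastI rev_rcons.
have pr : path e y r.
  rewrite /y /r rev_path; apply: sub_path pq => a b; by rewrite esym.
have ur : uniq (y :: r) by rewrite rE rev_uniq.
have [s [ps us hs]] := extend_path pr ur.
exists y, (r ++ s); split=> //.
- by rewrite -cat_cons mem_cat rE mem_rev inE eqxx.
- by move=> z /hq zq; rewrite -cat_cons mem_cat rE mem_rev zq.
Qed.

(** A path maximal at both ends exhausts its component, since its inner vertices already have two
    neighbours on it. The condition [1 < size p] keeps a single edge, traversed back and forth, from
    counting as a cycle. *)
Lemma degree_two_component x : exists y p,
  [/\ path e y p, uniq (y :: p), connect e x =i y :: p &
    (e (last y p) y /\ 1 < size p) \/
    [/\ forall z z', e y z -> e y z' -> z = z',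
      forall z z', e (last y p) z -> e (last y p) z' -> z = z' &
      forall i, 0 < i < size p -> 1 < #|e (nth x (y :: p) i)|]].
Proof.
have [y [p [py up xp hy hl]]] := maximal_path x.
exists y, p.
set c := y :: p in up xp hy hl *.
have adj i : i < size p -> e (nth x c i) (nth x c i.+1).
  by move=> ip; move/(pathP x): py => /(_ i ip).
have lastE : last y p = nth x c (size p) by rewrite -[size p]/(size c).-1 nth_last.
have szc : size c = (size p).+1 by [].
have y0 : y = nth x c 0 by [].
have single w : w \in c -> size p = 0 -> w = y.
  by move=> /(nthP x)[i]; rewrite szc y0 => + <- p0; rewrite p0; case: i.
clearbody c.
have mid i : 0 < i < size p ->
   [/\ e (nth x c i) (nth x c i.-1), e (nth x c i) (nth x c i.+1) &
     nth x c i.-1 != nth x c i.+1].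
  case/andP; case: i => // i _ ip; split; first by rewrite esym adj // ltnW.
    exact: adj.
  rewrite nth_uniq ?szc ?ltnS //; last by do 2 apply: ltnW.
  by rewrite ltn_eqF.
have closed_c z z' : z \in c -> e z z' -> z' \in c.
  move=> /(nthP x)[i ic <-]; rewrite szc ltnS in ic.
  case: (posnP i) => [->|i0]; first by rewrite -y0; exact: hy.
  case: (ltngtP i (size p)) ic => // [ip _|-> _]; last by rewrite -lastE; exact: hl.
  move=> ez.
  have [|m1 m2 m12] := mid i; first by rewrite i0.
  have := deg_le2P m1 m2 ez m12.
  by rewrite !inE => /orP[]/eqP->; apply: mem_nth; rewrite szc ltnS // (leq_trans (leq_pred _)) // ltnW.
have connc : connect e x =i c.
  move=> z; apply/idP/idP.
    move=> /connectP[q + ->]; elim: q {z} (x) xp => //= a q IHq b bc /andP[eba].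
    by apply: IHq; exact: closed_c eba.
  have yc w : w \in c -> connect e y w.
    move=> /(nthP x)[i + <-]; rewrite szc ltnS; elim: i => [_|i IHi ip].
      by rewrite -y0 connect0.
    by apply: connect_trans (IHi (ltnW ip)) (connect1 (adj i ip)).
  move=> /yc yz; apply: connect_trans yz.
  have csym : connect_sym e by apply: sym_connect_sym.
  by rewrite csym; exact: yc.
split=> //.
have [cyc|ncyc] := boolP (e (last y p) y && (1 < size p)); first by left; move/andP: cyc.
right; split.
- move=> z z' yz yz'; apply/eqP; apply: contraNT ncyc => zz'.
  have p0 : 0 < size p.
    rewrite lt0n; apply: contraTneq (yz) => /(single z (hy z yz)) ->.
    by rewrite eirr.
  (* A neighbour [w] of [y] other than its successor lies on the path at an index above 1. An inner
     [w] would have three neighbours, so [w] is the last vertex and the path closes up. *)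
  have [w yw w1] : exists2 w, e y w & w != nth x c 1.
    have [zE|] := eqVneq z (nth x c 1); last by exists z.
    by exists z' => //; rewrite eq_sym -zE.
  have /(nthP x)[i + wi] := hy w yw.
  rewrite szc ltnS => ip.
  case: (posnP i) wi => [-> wy|i0 wi]; first by move: yw; rewrite -wy -y0 eirr.
  have i1 : i != 1 by apply: contraNneq w1 => <-; rewrite wi.
  have {i0 i1}i1 : 1 < i by case: i i0 i1 {wi ip} => [|[]].
  case: (ltngtP i (size p)) ip => // [ip _|iE _].
    have [|m1 m2 m12] := mid i; first by rewrite ip ltnW.
    have : y \in [:: nth x c i.-1; nth x c i.+1].
      by apply: (deg_le2P m1 m2) => //; rewrite wi esym.
    rewrite !inE {1 2}y0 !nth_uniq // ?szc ?ltnS //; last first.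
      by rewrite (leq_trans (leq_pred _)) // ltnW.
    by case: (i) i1 => [|[]].
  by rewrite lastE -iE wi esym yw.
- move=> z z' yz yz'; apply/eqP; apply: contraNT ncyc => zz'.
  have p0 : 0 < size p.
    rewrite lt0n; apply: contraTneq (yz) => p0; rewrite (single z (hl z yz) p0).
    by rewrite (size0nil p0) eirr.
  have [w yw w1] : exists2 w, e (last y p) w & w != nth x c (size p).-1.
    have [zE|] := eqVneq z (nth x c (size p).-1); last by exists z.
    by exists z' => //; rewrite eq_sym -zE.
  have /(nthP x)[i + wi] := hl w yw.
  rewrite szc ltnS => ip.
  have i1 : i != (size p).-1 by apply: contraNneq w1 => <-; rewrite wi.
  have i2 : i != size p by apply: contraTneq yw => iE; rewrite -wi iE -lastE eirr.
  have {i2}ip : i < size p by rewrite ltn_neqAle i2.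
  have {i1}ip1 : i.+1 < size p by rewrite ltn_neqAle ip andbT; apply: contraNneq i1 => <-.
  case: (posnP i) wi => [iE wy|i0 wi].
    rewrite iE -y0 in wy; rewrite -wy in yw.
    by rewrite yw; apply: leq_trans ip1.
  have [|m1 m2 m12] := mid i; first by rewrite ip i0.
  have : last y p \in [:: nth x c i.-1; nth x c i.+1].
    by apply: (deg_le2P m1 m2) => //; rewrite wi esym.
  rewrite !inE lastE !nth_uniq // ?szc ?ltnS //; last first.
    by rewrite (leq_trans (leq_pred _)) // ltnW.
  rewrite gtn_eqF ?(gtn_eqF ip1) //.
  by rewrite (leq_ltn_trans (leq_pred _)).
- move=> i /mid[m1 m2 m12].
  have u : uniq [:: nth x c i.-1; nth x c i.+1] by rewrite /= inE m12.
  apply: (@leq_trans #|[:: nth x c i.-1; nth x c i.+1]|).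
    by rewrite (card_uniqP u).
  apply/subset_leq_card/fintype.subsetP => w.
  by rewrite !inE => /orP[]/eqP->; rewrite unfold_in.
Qed.

Lemma next_neq_prev (c : seq W) x : uniq c -> 2 < size c -> x \in c ->
  next c x != prev c x.
Proof.
move=> uc szc xc; apply/eqP => nE; have := next_prev uc x; rewrite -nE.
have [i s E] := rot_to xc.
rewrite -(next_rot i uc x) -(next_rot i uc); move: szc uc.
rewrite -(size_rot i) -(rot_uniq i) E; case: s {E} => [|a [|b s]] //= _.
rewrite !inE !negb_or eqxx => /andP[/and3P[xa xb _] _].
by rewrite eq_sym (negPf xa) eqxx => bx; rewrite bx eqxx in xb.
Qed.

Lemma ucycle_neighbors (c : seq W) x y : ucycle e c -> 2 < size c -> x \in c ->
  e x y -> y = next c x \/ y = prev c x.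
Proof.
move=> /andP[cc uc] szc xc exy.
have := deg_le2P (next_cycle cc xc) _ exy (next_neq_prev uc szc xc).
by rewrite esym (prev_cycle cc xc) !inE => /(_ isT)/orP[]/eqP->; [left | right].
Qed.

Lemma ucycle_degree (c : seq W) x : ucycle e c -> 2 < size c -> x \in c ->
  1 < #|e x|.
Proof.
move=> /andP[cc uc] szc xc.
have u : uniq [:: next c x; prev c x] by rewrite /= inE next_neq_prev.
apply: (@leq_trans #|[:: next c x; prev c x]|); first by rewrite (card_uniqP u).
apply/subset_leq_card/fintype.subsetP => w.
rewrite !inE => /orP[]/eqP->; rewrite unfold_in ?next_cycle //.
by rewrite esym prev_cycle.
Qed.

(** When all degrees are at most two, this singles out the components that are cycles. *)
Definition cyclic_component x := [forall y, connect e x y ==> (1 < #|e y|)].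

Lemma cyclic_component_ucycle x : cyclic_component x ->
  exists c, [/\ ucycle e c, 2 < size c & connect e x =i c].
Proof.
move=> /forallP xcyc.
have [y [p [py up xp [[ly szp]|[hy _ _]]]]] := degree_two_component x.
  by exists (y :: p); split=> //; rewrite /ucycle up /= rcons_path py ly.
have /implyP := xcyc y; rewrite -[connect e x y]/(y \in connect e x).
rewrite xp mem_head => /(_ isT)/card_gt1P[a [b [ya yb]]].
by rewrite (hy a b ya yb) eqxx.
Qed.

Hypothesis deg_gt0 : forall x, 0 < #|e x|.

(** A component that is not a cycle is a path, and [deg_gt0] excludes a path reduced to one vertex,
    so its two ends are distinct. *)
Lemma card_endpoints_component x :
  #|[pred y | (#|e y| == 1) && connect e x y]| = (~~ cyclic_component x).*2.
Proof.
have [xcyc|] := boolP (cyclic_component x).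
  apply: eq_card0 => y; rewrite inE; apply/negbTE/negP => /andP[/eqP y1 xy].
  by move: xcyc => /forallP/(_ y)/implyP/(_ xy); rewrite y1.
have [y [p [py up xp [[ly szp]|[hy hl hm]]]]] := degree_two_component x.
  move/negP; case; apply/forallP => z; apply/implyP => xz.
  have uc : ucycle e (y :: p) by rewrite /ucycle up /= rcons_path py ly.
  by apply: (ucycle_degree uc) => //; rewrite -xp.
move=> _; rewrite /=.
have y1 : #|e y| == 1.
  by rewrite eqn_leq deg_gt0 andbT; apply/card_le1_eqP => a b ya yb; exact: hy.
have l1 : #|e (last y p)| == 1.
  by rewrite eqn_leq deg_gt0 andbT; apply/card_le1_eqP => a b ya yb; exact: hl.
have yl : y != last y p.
  case: p up xp {py hl hm l1} hy => [_ xp hy|a p /= /andP[yp _] _ _].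
    have /card_gt0P[z yz] := deg_gt0 y.
    have : z \in connect e x.
      by apply: connect_trans (connect1 yz); rewrite -[connect _ _ _]/(y \in connect e x) xp mem_head.
    by rewrite xp inE => /eqP zy; move: yz; rewrite zy unfold_in eirr.
  by apply: contraNneq yp => ->; rewrite mem_last.
transitivity #|[:: y; last y p]|; last first.
  by apply/card_uniqP; rewrite /= inE yl.
apply: eq_card => z; rewrite !inE -[connect e x z]/(z \in connect e x) xp.
apply/andP/orP => [[z1 zp]|[]/eqP->]; last 2 first.
- by rewrite mem_head.
- by rewrite mem_last.
move: zp z1 => /(nthP x)[i + <-]; rewrite [size _]/= ltnS => ip.
case: (posnP i) => [-> _|i0]; first by left.
case: (ltngtP i (size p)) ip => // [ip _|-> _ _].
  by have := hm i; rewrite i0 ip => /(_ isT)/gtn_eqF ->.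
by right; rewrite -[size p]/(size (y :: p)).-1 nth_last.
Qed.

(** Sort the vertices of degree one by component: each path contributes two of them and each cycle
    none. *)
Lemma double_n_comp : (n_comp e predT).*2 =
  #|[pred r | roots e r & cyclic_component r]|.*2 + #|[pred x | #|e x| == 1]|.
Proof.
have csym : connect_sym e by exact: sym_connect_sym.
rewrite -[#|[pred x | #|e x| == 1]|]sum1_card (partition_big (fingraph.root e) (roots e)) /=; last first.
  by move=> x _; exact: roots_root.
rewrite (eq_bigr (fun r => (~~ cyclic_component r).*2)) => [|r rr]; last first.
  rewrite -card_endpoints_component sum1_card; apply: eq_card => x.
  by rewrite !inE -root_connect // (eqP rr) [r == _]eq_sym.
have -> : n_comp e predT = \sum_(r | roots e r) 1.
  by rewrite /n_comp_mem -sum1_card; apply: eq_bigl => x; rewrite !inE andbT.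
rewrite -sum1_card.
rewrite (bigID cyclic_component) /= doubleD; congr (_ + _).
rewrite -mul2n big_distrr big_mkcondr /=. apply: eq_bigr => r _.
by rewrite muln1; case: cyclic_component.
Qed.
End DegreeTwo.

Local Open Scope classical_set_scope.
Local Open Scope ring_scope.

(** * Geometry of the triangular lattice *)

(** Linear inequalities turn incidence questions into goals for [lia]. *)
Lemma in_corners (a b r s : int) (up : bool) :
  ((a, b) \in corners (r, s, up)) =
  (if up then [&& r <= a, s <= b & a + b <= r + s + 1]
   else [&& a <= r + 1, b <= s + 1 & r + s + 1 <= a + b]).
Proof. by case: up; rewrite !inE !xpair_eqE; lia. Qed.

Lemma card_corners t : #|` corners t| = 3%N.
Proof.
case: t => [[r s] []] /=; rewrite -!fsetUA !cardfsU1 cardfs1 !inE !xpair_eqE; lia.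
Qed.

Lemma corners_inj : injective corners.
Proof.
move=> [[r s] b] [[r' s'] b'] /fsetP E.
have {}E a c : ((a, c) \in corners (r, s, b)) = ((a, c) \in corners (r', s', b')).
  exact: E.
have := (E r s, E (r + 1) s, E r (s + 1), E (r + 1) (s + 1)).
have := (E r' s', E (r' + 1) s', E r' (s' + 1), E (r' + 1) (s' + 1)).
rewrite !in_corners => -[[[e1 e2] e3] e4] [[[e5 e6] e7] e8] {E}.
suff : [&& r == r', s == s' & b == b'] by case/and3P => /eqP-> /eqP-> /eqP->.
by case: b b' e1 e2 e3 e4 e5 e6 e7 e8 => [] [] /=; lia.
Qed.

(** The form [r^2 + rs + s^2] takes the value 1 at six points only, the nonzero integer points of a
    hexagon cut out by linear inequalities. *)
Lemma tadjE u v : tadj u v = (u != v) &&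
  [&& `|v.1 - u.1| <= 1, `|v.2 - u.2| <= 1 & `|v.1 - u.1 + (v.2 - u.2)| <= 1].
Proof.
case: u v => a b [a' b']; rewrite /tadj xpair_eqE /=.
set r := a' - a; set s := b' - b.
have -> : (a == a') && (b == b') = (r == 0) && (s == 0) by rewrite /r /s; lia.
move: r s => {a a' b b'} r s; apply/idP/idP => [/eqP rs|].
  have {}rs : r * r + r * s + s * s = 1 by rewrite -!expr2.
  have : (r = -1 \/ r = 0 \/ r = 1) by nia.
  have : (s = -1 \/ s = 0 \/ s = 1) by nia.
  by case=> [?|[?|?]] [?|[?|?]]; subst; lia.
case/andP => rs0 /and3P[r1 s1 rs1].
have : (r = -1 \/ r = 0 \/ r = 1) by lia.
have : (s = -1 \/ s = 0 \/ s = 1) by lia.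
by case=> [?|[?|?]] [?|[?|?]]; subst.
Qed.

Lemma tadj_sym : symmetric tadj.
Proof. by move=> u v; rewrite !tadjE eq_sym; lia. Qed.

Lemma corners_tadj t u v : u \in corners t -> v \in corners t -> u != v -> tadj u v.
Proof.
move=> + + uv; rewrite tadjE uv.
by case: t u v {uv} => [[r s] []] [a b] [a' b']; rewrite !in_corners /=; lia.
Qed.

(** Together with [tadj_faces], this says that an edge of the triangular lattice lies in exactly two
    faces, the endpoints of its dual edge. *)
Lemma faces_of_edge u v t t' t'' : u != v ->
  u \in corners t -> v \in corners t -> u \in corners t' -> v \in corners t' ->
  u \in corners t'' -> v \in corners t'' -> t != t' -> t'' = t \/ t'' = t'.
Proof.
case: u v t t' t'' => a b [a' b'] [[r s] d] [[r' s'] d'] [[r'' s''] d''].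
rewrite !in_corners !xpair_eqE => uv ut vt ut' vt' ut'' vt'' tt'.
suff : [&& r'' == r, s'' == s & d'' == d] || [&& r'' == r', s'' == s' & d'' == d'].
  by case/orP => /and3P[/eqP-> /eqP-> /eqP->]; [left | right].
by case: d d' d'' ut vt ut' vt' ut'' vt'' tt' => [] [] []; lia.
Qed.

Lemma tadj_faces u v : tadj u v -> exists t t',
  [/\ t != t', u \in corners t, v \in corners t, u \in corners t' & v \in corners t'].
Proof.
case: u v => a b [a' b']; rewrite tadjE xpair_eqE /= => uv.
have : ((b' = b /\ a' = a + 1) \/ (b' = b /\ a' = a - 1)) \/
  ((a' = a /\ b' = b + 1) \/ (a' = a /\ b' = b - 1)) \/
  ((a' = a + 1 /\ b' = b - 1) \/ (a' = a - 1 /\ b' = b + 1)) by lia.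
case=> [[]|[[]|[]]] [-> ->] {uv};
  [exists (a, b, true), (a, b - 1, false)
  | exists (a - 1, b, true), (a - 1, b - 1, false)
  | exists (a, b, true), (a - 1, b, false)
  | exists (a, b - 1, true), (a - 1, b - 1, false)
  | exists (a, b - 1, true), (a, b - 1, false)
  | exists (a - 1, b, true), (a - 1, b, false)];
  rewrite !in_corners !xpair_eqE; split; lia.
Qed.

Lemma corners_third t u v : u \in corners t -> v \in corners t -> u != v ->
  exists w, [/\ w != u, w != v & corners t = [fset u; v; w]%fset].
Proof.
move=> ut vt uv.
have : #|` (corners t `\` [fset u; v])%fset| = 1%N.
  rewrite cardfsDS ?card_corners ?cardfs2 ?uv //.
  by apply/fsubsetP => w; rewrite !inE => /orP[]/eqP->.
move=> /eqP/cardfs1P[w wE]; exists w.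
have : w \in (corners t `\` [fset u; v])%fset by rewrite wE inE.
rewrite !inE negb_or => /andP[/andP[wu wv] wt]; split=> //.
apply/fsetP => z; have /fsetP/(_ z) := wE; rewrite !inE.
have [->|] := eqVneq z u; first by rewrite ut.
by have [->|] := eqVneq z v; first by rewrite vt.
Qed.

Lemma corners_meet t t' u v : t != t' -> u != v ->
  u \in corners t -> v \in corners t -> u \in corners t' -> v \in corners t' ->
  (corners t `&` corners t' = [fset u; v])%fset.
Proof.
move=> tt' uv ut vt ut' vt'.
have [w [wu wv tE]] := corners_third ut vt uv.
have wt' : w \notin corners t'.
  apply: contraNN tt' => wt'; apply/eqP/corners_inj/eqP.
  rewrite eqEfcard !card_corners leqnn andbT tE; apply/fsubsetP => z.
  by rewrite !inE => /orP[/orP[]|]/eqP->.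
apply/fsetP => z; rewrite inE tE !inE.
have [->|zu] := eqVneq z u; first by rewrite ut'.
have [->|zv] := eqVneq z v; first by rewrite vt'.
by have [->|//] := eqVneq z w; rewrite (negPf wt').
Qed.

Lemma cardfs2P (K : choiceType) (A : {fset K}) :
  reflect (exists u v, u != v /\ A = [fset u; v]%fset) (#|` A| == 2%N).
Proof.
apply: (iffP idP) => [/eqP A2|[u [v [uv ->]]]]; last by rewrite cardfs2 uv.
have /fset0Pn[u uA] : A != fset0 by rewrite -cardfs_gt0 A2.
have /eqP/cardfs1P[v vE] : #|` (A `\ u)%fset| = 1%N.
  by move: A2; rewrite (cardfsD1 u A) uA => -[].
exists u, v; split; last by rewrite -vE fsetD1K.
have : v \in (A `\ u)%fset by rewrite vE inE.
by rewrite !inE eq_sym => /andP[].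
Qed.

Lemma hadjP t t' : reflect
  (exists u v, [/\ u != v, t != t' & (corners t `&` corners t' = [fset u; v])%fset])
  (hadj t t').
Proof.
rewrite /hadj; apply: (iffP (cardfs2P _)) => [[u [v [uv E]]]|[u [v [uv tt' E]]]].
  exists u, v; split=> //; apply: contra_eq_neq E => ->; rewrite fsetIid.
  by apply/negP => /eqP E; have := card_corners t'; rewrite E cardfs2 uv.
by exists u, v.
Qed.

Lemma common_corners_hadj t t' u v : t != t' -> u != v ->
  u \in corners t -> v \in corners t -> u \in corners t' -> v \in corners t' ->
  hadj t t'.
Proof.
by move=> tt' uv *; apply/hadjP; exists u, v; split=> //; exact: corners_meet.
Qed.

(** * Potentials of closed edge functions *)

(** The primitive of [h] modulo 2 that vanishes at 0. As [Negz n] stands for -(n + 1), its sum has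
    [n.+1] terms. *)
Definition xor_primitive (h : int -> bool) (i : int) : bool :=
  match i with
  | Posz n => \big[addb/false]_(k < n) h k
  | Negz n => \big[addb/false]_(k < n.+1) h (Negz k)
  end.

Lemma xor_primitiveD1 h i : xor_primitive h (i + 1) = xor_primitive h i (+) h i.
Proof.
case: i => n.
  have -> : n%:Z + 1 = n.+1 by lia. by rewrite /= big_ord_recr.
have -> : Negz n + 1 = - n%:Z by rewrite NegzE; lia.
case: n => [|n]; first by rewrite /= !big_ord_recr !big_ord0 /= addbb.
by rewrite -NegzE /= [in RHS]big_ord_recr /= -addbA addbb addbF.
Qed.

(** The corners may coincide, which forces [g u u = false] and the symmetry of [g] on each face. *)
Definition cocycle (B : set hexagon) (g : hexagon -> hexagon -> bool) := forall t u v w,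
  u \in corners t -> v \in corners t -> w \in corners t -> B u -> B v -> B w ->
  g u v (+) g v w = g u w.

(** The potential sums [g] along the axis [s = 0], then along a column. Its vertical increments are
    right by construction, so only the horizontal ones need the cocycle condition. *)
Lemma triangle_potential g : cocycle setT g ->
  exists f : hexagon -> bool, forall t u v, u \in corners t -> v \in corners t ->
    g u v = f u (+) f v.
Proof.
move=> gC.
have {}gC t u v w : u \in corners t -> v \in corners t -> w \in corners t ->
  g u v (+) g v w = g u w by move=> *; exact: (gC t).
pose f (u : hexagon) := xor_primitive (fun k => g (k, 0) (k + 1, 0)) u.1
  (+) xor_primitive (fun k => g (u.1, k) (u.1, k + 1)) u.2.
have g0 u : g u u = false.
  have u1 : u \in corners (u, true) by case: u => a b; rewrite in_corners; lia.
  by have := gC _ _ _ _ u1 u1 u1; rewrite addbb => <-.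
have gsym t u v : u \in corners t -> v \in corners t -> g u v = g v u.
  by move=> ut vt; have := gC _ _ _ _ ut vt ut; rewrite g0; case: (g u v) (g v u) => [] [].
have fV i j : f (i, j + 1) = f (i, j) (+) g (i, j) (i, j + 1).
  by rewrite /f /= xor_primitiveD1 addbA.
have fH i j : f (i + 1, j) = f (i, j) (+) g (i, j) (i + 1, j).
  (* The two faces of a rhombus share its diagonal, so the horizontal increment is right on its
     lower side exactly when it is right on its upper side. Both directions serve, for rows above
     and below the axis. *)
  have step k : (f (i + 1, k) = f (i, k) (+) g (i, k) (i + 1, k)) <->
     (f (i + 1, k + 1) = f (i, k + 1) (+) g (i, k + 1) (i + 1, k + 1)).
    rewrite !fV.
    have <- : g (i, k) (i + 1, k) (+) g (i + 1, k) (i, k + 1) = g (i, k) (i, k + 1).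
      by apply: (gC (i, k, true)); rewrite in_corners; lia.
    have <- : g (i + 1, k) (i, k + 1) (+) g (i, k + 1) (i + 1, k + 1) =
        g (i + 1, k) (i + 1, k + 1).
      by apply: (gC (i, k, false)); rewrite in_corners; lia.
    by case: (f _) (f _) (g _ _) (g _ _) (g _ _) => [] [] [] [] []; split.
  elim/int_rec: j => [|n IHn|n IHn]; first by rewrite /f /= !big_ord0 !addbF xor_primitiveD1.
    have -> : n.+1%:Z = n%:Z + 1 by lia. exact: (proj1 (step _)).
  by apply: (proj2 (step _)); rewrite (_ : - n.+1%:Z + 1 = - n%:Z) //; lia.
exists f => t.
(* From the corner [c] one side of the face is horizontal and the other vertical; the cocycle
   condition then yields the diagonal side. *)
have [c [ct fc]] : exists c, c \in corners t /\
    forall u, u \in corners t -> g c u = f c (+) f u.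
  case: t => [[r s] []].
    exists (r, s); split=> [|u]; first by rewrite in_corners; lia.
    by rewrite !inE => /orP[/orP[]|] /eqP->; rewrite ?g0 ?fV ?fH ?addbb // addbA addbb.
  exists (r + 1, s + 1); split=> [|u ut]; first by rewrite in_corners; lia.
  rewrite (gsym _ _ _ _ ut) ?in_corners; last by lia.
  move: ut; rewrite !inE => /orP[/orP[]|] /eqP->; rewrite ?g0 ?addbb //.
    by rewrite fV addbAC addbb.
  by rewrite fH addbAC addbb.
move=> u v ut vt; rewrite -(gC t u c v) // (gsym t) // !fc //.
by rewrite addbACA addbb.
Qed.

(** Connectedness is phrased through functions invariant under adjacency, so that composing with a
    retraction transports it to the box. *)
Lemma tadj_connected (T : Type) (f : hexagon -> T) :
  (forall u v, tadj u v -> f u = f v) -> forall u v, f u = f v.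
Proof.
move=> fE.
suff H u : f u = f (0, 0) by move=> u v; rewrite !H.
have fV i j : f (i, j) = f (i, j + 1) by apply: fE; rewrite tadjE xpair_eqE /=; lia.
have fH i j : f (i, j) = f (i + 1, j) by apply: fE; rewrite tadjE xpair_eqE /=; lia.
case: u => i j; transitivity (f (i, 0)).
  elim/int_rec: j => [//|n <-|n <-].
    by rewrite [RHS]fV; congr (f (_, _)); lia.
  by rewrite [LHS]fV; congr (f (_, _)); lia.
elim/int_rec: i => [//|n <-|n <-].
  by rewrite [RHS]fH; congr (f (_, _)); lia.
by rewrite [LHS]fH; congr (f (_, _)); lia.
Qed.

(** * Boxes and the retraction onto them *)

Definition box (N : nat) : set hexagon :=
  [set u | (`|u.1| <= N%:Z) && (`|u.2| <= N%:Z)].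

Definition clamp_int (N : nat) (i : int) : int :=
  if i < - N%:Z then - N%:Z else if N%:Z < i then N%:Z else i.

(* A simplicial retraction onto the box. *)
Definition clamp (N : nat) (u : hexagon) : hexagon :=
  (clamp_int N u.1, clamp_int N u.2).

Lemma clamp_intP N i : [\/ i < - N%:Z /\ clamp_int N i = - N%:Z,
  N%:Z < i /\ clamp_int N i = N%:Z |
  - N%:Z <= i <= N%:Z /\ clamp_int N i = i].
Proof.
rewrite /clamp_int; case: ltP => h1; first by apply: Or31.
by case: ltP => h2; [apply: Or32 | by apply: Or33; split=> //; apply/andP; split].
Qed.

Lemma clamp_int_bounds N i : - N%:Z <= clamp_int N i <= N%:Z.
Proof. by have [] := clamp_intP N i; lia. Qed.

Lemma clamp_int_lipschitz N i j : i <= j ->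
  clamp_int N i <= clamp_int N j <= clamp_int N i + (j - i).
Proof.
move=> ij; have [[h1 ->]|[h1 ->]|[h1 ->]] := clamp_intP N i;
  have [[h2 ->]|[h2 ->]|[h2 ->]] := clamp_intP N j; lia.
Qed.

Lemma clamp_box N u : box N (clamp N u).
Proof.
rewrite /box /clamp /=; move: (clamp_int_bounds N u.1) (clamp_int_bounds N u.2); lia.
Qed.

Lemma clamp_id N u : box N u -> clamp N u = u.
Proof.
case: u => a b; rewrite /box /clamp /= => ab.
by congr (_, _); [have [] := clamp_intP N a | have [] := clamp_intP N b]; lia.
Qed.

(** Clamping a coordinate is monotone and 1-Lipschitz. An upward face is anchored at its lower left
    corner and a downward one at its upper right corner, whence the shift by one. *)
Lemma clamp_corners N t :
  exists t', forall u, u \in corners t -> clamp N u \in corners t'.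
Proof.
case: t => [[r s] []].
  exists (clamp_int N r, clamp_int N s, true) => -[a b].
  rewrite /clamp !in_corners => /and3P[ra sb ab] /=.
  by move: (clamp_int_lipschitz N ra) (clamp_int_lipschitz N sb); lia.
exists (clamp_int N (r + 1) - 1, clamp_int N (s + 1) - 1, false) => -[a b].
rewrite /clamp !in_corners => /and3P[ra sb ab] /=.
by move: (clamp_int_lipschitz N ra) (clamp_int_lipschitz N sb); lia.
Qed.

(** The pull-back of [g] along the retraction is closed on the whole lattice and equals [g] inside
    the box. *)
Lemma box_potential N g : cocycle (box N) g ->
  exists f : hexagon -> bool, forall t u v, u \in corners t -> v \in corners t ->
    box N u -> box N v -> g u v = f u (+) f v.
Proof.
move=> gC; have [|f fE] := @triangle_potential (fun u v => g (clamp N u) (clamp N v)).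
  move=> t u v w ut vt wt _ _ _; have [t' H] := clamp_corners N t.
  by apply: (gC t'); rewrite ?H //; exact: clamp_box.
by exists f => t u v ut vt uB vB; rewrite -(fE t) ?clamp_id.
Qed.

Lemma box_connected N (T : Type) (f : hexagon -> T) :
  (forall u v, tadj u v -> box N u -> box N v -> f u = f v) ->
  forall u v, box N u -> box N v -> f u = f v.
Proof.
move=> fE u v uB vB; rewrite -[u](@clamp_id N) // -[v](@clamp_id N) //.
apply: (tadj_connected (f := fun u => f (clamp N u))) => {uB vB}u {}v uv.
have [t [_ [_ ut vt _ _]]] := tadj_faces uv; have [t' H] := clamp_corners N t.
have [->//|cuv] := eqVneq (clamp N u) (clamp N v).
by apply: fE (clamp_box _ _) (clamp_box _ _); apply: corners_tadj cuv; exact: H.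
Qed.

(** * Clusters and interfaces in a box *)

Lemma box_finite N : finite_set (box N).
Proof.
pose h (p : nat * nat) : hexagon := (p.1%:Z - N%:Z, p.2%:Z - N%:Z).
apply: (@sub_finite_set _ _ (h @` (`I_(N + N).+1 `*` `I_(N + N).+1))).
  case=> a b; rewrite /box /= => ab; exists (absz (a + N%:Z), absz (b + N%:Z)) => /=.
    by split; lia.
  by rewrite /h /=; congr (_, _); lia.
by apply: finite_image; apply: finite_setX; exact: finite_II.
Qed.

(** Merges finitely many thresholds into one; each requirement on the size of the box is obtained
    this way. *)
Lemma uniform_bound (I : eqType) (A : set I) (P : nat -> I -> Prop) : finite_set A ->
  (forall i, A i -> exists N, forall M, (N <= M)%N -> P M i) ->
  exists N, forall M, (N <= M)%N -> forall i, A i -> P M i.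
Proof.
move=> /finite_seqP[s ->]; elim: s => [_|i s IHs iP]; first by exists 0%N.
have [|N NP] := IHs; first by move=> j js; apply: iP; rewrite /= inE js orbT.
have [|N' N'P] := iP i; first by rewrite /= inE eqxx.
exists (maxn N N') => M; rewrite geq_max => /andP[NM N'M] j /=; rewrite inE.
by case/orP => [/eqP->|]; [exact: N'P | exact: NP].
Qed.

Lemma finite_in_box (G : set hexagon) : finite_set G ->
  exists N, forall M, (N <= M)%N -> G `<=` box M.
Proof.
move=> /(uniform_bound (P := box)); apply => u _.
by exists (absz u.1 + absz u.2)%N => M; rewrite /box /=; lia.
Qed.

Definition faces (G : set hexagon) : set hvertex :=
  [set t | exists2 u, G u & u \in corners t].

Lemma faces_finite G : finite_set G -> finite_set (faces G).
Proof.
move=> /finite_in_box[N /(_ _ (leqnn N)) GN].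
apply: (@sub_finite_set _ _ (box N.+1 `*` setT)).
  case=> [[r s] b] [[a c] /GN + ] /=.
  by rewrite in_corners /box /=; case: b => abrs ab; split=> //; lia.
by apply: finite_setX (box_finite _) _; exact: finite_finset.
Qed.

Definition box_type N : finType := fset_set (box N).

Lemma box_val N (x : box_type N) : box N (val x).
Proof. by have := valP x; rewrite in_fset_set ?inE //; exact: box_finite. Qed.

Lemma box_typeP N u : box N u -> {x : box_type N | val x = u}.
Proof.
move=> uB; have uf : u \in fset_set (box N).
  by rewrite in_fset_set ?inE //; exact: box_finite.
by exists [` uf]%fset.
Qed.

Definition mono N (sigma : spin_config) : rel (box_type N) :=
  fun x y => tadj (val x) (val y) && (sigma (val x) == sigma (val y)).

Definition bichromatic N (sigma : spin_config) u v :=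
  [/\ box N u, box N v & sigma u != sigma v].

(** Only the two corners of the bichromatic edge must lie in the box: a face that straddles the
    boundary is kept and becomes the end of an interface. *)
Definition crossed N sigma : set hvertex := [set t | exists u v,
  [/\ u \in corners t, v \in corners t & bichromatic N sigma u v]].

Lemma crossed_finite N sigma : finite_set (crossed N sigma).
Proof.
apply: sub_finite_set (faces_finite (box_finite N)).
by move=> t [u [v [ut _ [uB _ _]]]]; exists u.
Qed.

Definition crossed_type N sigma : finType := fset_set (crossed N sigma).

Lemma crossed_val N sigma (t : crossed_type N sigma) : crossed N sigma (val t).
Proof. by have := valP t; rewrite in_fset_set ?inE //; exact: crossed_finite. Qed.

Lemma crossed_typeP N sigma t : crossed N sigma t ->
  {x : crossed_type N sigma | val x = t}.
Proof.
move=> tB; have tf : t \in fset_set (crossed N sigma).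
  by rewrite in_fset_set ?inE //; exact: crossed_finite.
by exists [` tf]%fset.
Qed.

Definition link_at N sigma (t t' : hvertex) := exists u v,
  [/\ u \in corners t, v \in corners t, u \in corners t', v \in corners t' &
      bichromatic N sigma u v].

Definition link N sigma : rel (crossed_type N sigma) :=
  fun x y => (x != y) && `[< link_at N sigma (val x) (val y) >].

Lemma mono_sym N sigma : symmetric (@mono N sigma).
Proof. by move=> x y; rewrite /mono tadj_sym eq_sym. Qed.

Lemma link_atC N sigma t t' : link_at N sigma t t' -> link_at N sigma t' t.
Proof. by move=> [u [v []]]; exists u, v. Qed.

Lemma link_sym N sigma : symmetric (@link N sigma).
Proof.
by move=> x y; rewrite /link eq_sym; congr (_ && _); apply/asboolP/asboolP => /link_atC.
Qed.

Lemma link_irr N sigma : irreflexive (@link N sigma).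
Proof. by move=> x; rewrite /link eqxx. Qed.

Section ClustersInterfaces.
Variables (N : nat) (sigma : spin_config).
Let V := box_type N.
Let W := crossed_type N sigma.

Definition boxext (f : {ffun V -> bool}) (u : hexagon) : bool := oapp f false (insub u).

Lemma boxextE f x : boxext f (val x) = f x.
Proof. by rewrite /boxext valK. Qed.

(* The coboundary of [f] takes one and the same value on all bichromatic edges
   of the face [t] when [f] is constant on clusters; this is that value. *)
Definition varies (f : {ffun V -> bool}) t := `[< exists u v,
  [/\ u \in corners t, v \in corners t, box N u, box N v & boxext f u != boxext f v] >].

Lemma mono_const f u v : f \in locally_constant (@mono N sigma) ->
  box N u -> box N v -> tadj u v -> sigma u = sigma v -> boxext f u = boxext f v.
Proof.
move=> /locally_constantP fE /box_typeP[x <-] /box_typeP[y <-] xy sxy.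
by rewrite !boxextE; apply: fE; rewrite /mono xy sxy eqxx.
Qed.

(** With two spins available, every corner shares its spin with [u] or [v], so on the corners of [t]
    in the box [f] takes only its values at [u] and [v]. *)
Lemma variesE f t u v : f \in locally_constant (@mono N sigma) ->
  u \in corners t -> v \in corners t -> bichromatic N sigma u v ->
  varies f t = (boxext f u != boxext f v).
Proof.
move=> fA ut vt [uB vB suv]; apply/asboolP/idP => [|fuv]; last by exists u, v.
apply: contraPP => /negP; rewrite negbK => /eqP fuv.
have fw w : w \in corners t -> box N w -> boxext f w = boxext f u.
  move=> wt wB.
  have [->//|wu] := eqVneq w u; have [->//|wv] := eqVneq w v.
  have [swu|] := eqVneq (sigma w) (sigma u).
    by apply: mono_const (fA) wB uB _ swu; exact: corners_tadj wt ut wu.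
  move=> swu; rewrite fuv; apply: (mono_const fA) => //; first exact: corners_tadj wt vt wv.
  by move: swu suv; case: (sigma w) (sigma u) (sigma v) => [] [] [].
by case=> a [b [at_ bt aB bB]]; rewrite !fw // eqxx.
Qed.

(** A function on the interfaces is encoded on their vertices, the crossed faces. The factor 2 is
    the value at the origin, which the coboundary forgets. *)
Lemma card_mono_link :
  #|locally_constant (@mono N sigma)| = (2 * #|locally_constant (@link N sigma)|)%N.
Proof.
have org : box N (0, 0) by rewrite /box /=; lia.
have [x0 _] := box_typeP org.
pose phi (f : {ffun V -> bool}) : bool * {ffun W -> bool} :=
  (f x0, [ffun t => varies f (val t)]).
have phi_inj : {in locally_constant (@mono N sigma) &, injective phi}.
  move=> f f' fA f'A [fo /ffunP fV]; apply/ffunP => x.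
  suff : boxext f (val x) (+) boxext f' (val x) = boxext f (val x0) (+) boxext f' (val x0).
    by rewrite !boxextE fo addbb; case: (f x) (f' x) => [] [].
  (* Along a monochromatic edge neither function changes; along a bichromatic one both change or
     neither does. Hence their difference is constant on the box. *)
  apply: (@box_connected N _ (fun u => boxext f u (+) boxext f' u)); try exact: box_val.
  move=> u v uv uB vB.
  have [t [_ [_ ut vt _ _]]] := tadj_faces uv.
  have [suv|suv] := eqVneq (sigma u) (sigma v).
    by rewrite (mono_const fA uB vB uv suv) (mono_const f'A uB vB uv suv).
  have buv : bichromatic N sigma u v by [].
  have tW : crossed N sigma t by exists u, v.
  have [t' tE] := crossed_typeP tW.
  have := fV t'; rewrite !ffunE tE (variesE fA ut vt buv) (variesE f'A ut vt buv).
  by case: (boxext f u) (boxext f v) (boxext f' u) (boxext f' v) => [] [] [] [].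
rewrite -(card_in_imset phi_inj).
suff -> : phi @: locally_constant (@mono N sigma) =
  finset.setX [set: bool]%SET (locally_constant (@link N sigma)).
  by rewrite cardsX cardsT card_bool.
apply/setP => -[b h]; rewrite finset.in_setX finset.in_setT /=; apply/imsetP/idP => [[f fA [_ ->]]|hA].
  apply/locally_constantP => x y /andP[_ /asboolP].
  case=> u [v [ut vt ut' vt' uv]]; rewrite !ffunE.
  by rewrite (variesE fA ut vt uv) (variesE fA ut' vt' uv).
(* [g] puts the value of [h] on the bichromatic edges. Two faces sharing such an edge of the box are
   linked, so they assign it the same value. *)
pose g u v := (sigma u != sigma v) &&
  `[< exists x : W, [/\ u \in corners (val x), v \in corners (val x) & h x] >].
have gE (x : W) u v : u \in corners (val x) -> v \in corners (val x) ->
    box N u -> box N v -> g u v = (sigma u != sigma v) && h x.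
  move=> ux vx uB vB; rewrite /g; have [//|suv] := eqVneq (sigma u) (sigma v).
  apply/asboolP/idP => [[y [uy vy]]|hx]; last by exists x.
  have [->//|yx] := eqVneq y x.
  rewrite (locally_constantP _ _ hA y x) // /link yx; apply/asboolP.
  by exists u, v.
(* Around a face an even number of edges is bichromatic, and all of them carry the value of [h] at
   that face. *)
have gC : cocycle (box N) g.
  move=> t u v w ut vt wt uB vB wB.
  have [suv|suv] := eqVneq (sigma u) (sigma v).
    have [suw|suw] := eqVneq (sigma u) (sigma w).
      by rewrite /g -suw -suv eqxx.
    have tW : crossed N sigma t by exists u, w.
    have [x tE] := crossed_typeP tW; rewrite !(gE x) ?tE //.
    by case: (sigma u) (sigma v) (sigma w) (h x) => [] [] [] [].
  have tW : crossed N sigma t by exists u, v.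
  have [x tE] := crossed_typeP tW; rewrite !(gE x) ?tE //.
  by case: (sigma u) (sigma v) (sigma w) (h x) => [] [] [] [].
have [f0 f0E] := box_potential gC.
(* The potential is only determined up to a flip; the added constant gives it the value [b] at the
   origin. *)
pose f : {ffun V -> bool} := [ffun y : V => f0 (val y) (+) (f0 (val x0) (+) b)].
have fV u : box N u -> boxext f u = f0 u (+) (f0 (val x0) (+) b).
  by move=> /box_typeP[y <-]; rewrite boxextE ffunE.
have fA : f \in locally_constant (@mono N sigma).
  apply/locally_constantP => x y /andP[xy sxy]; rewrite !ffunE; congr (_ (+) _).
  have [t [_ [_ xt yt _ _]]] := tadj_faces xy.
  have := f0E t _ _ xt yt (box_val x) (box_val y).
  by rewrite /g sxy /=; case: (f0 _) (f0 _) => [] [].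
exists f => //; congr (_, _); first by rewrite ffunE addbA addbb.
apply/ffunP => t; rewrite ffunE.
have [u [v [ut vt buv]]] := crossed_val t; have [uB vB suv] := buv.
rewrite (variesE fA ut vt buv) !fV //.
have := f0E _ _ _ ut vt uB vB; rewrite (gE t) // suv /= => ->.
by case: (f0 u) (f0 v) (f0 _ (+) b) => [] [] [].
Qed.
End ClustersInterfaces.

Lemma n_comp_mono_link N sigma :
  n_comp (@mono N sigma) predT = (n_comp (@link N sigma) predT).+1.
Proof.
have /eqP := card_mono_link N sigma.
rewrite !card_locally_constant -?expnS ?eqn_exp2l //; first by move/eqP.
  exact/sym_connect_sym/link_sym.
exact/sym_connect_sym/mono_sym.
Qed.

Lemma other_face t u v : u \in corners t -> v \in corners t -> u != v ->
  exists t', [/\ t != t', u \in corners t' & v \in corners t'].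
Proof.
move=> ut vt uv; have [t1 [t2 [t12 u1 v1 u2 v2]]] := tadj_faces (corners_tadj ut vt uv).
by have [tE|] := eqVneq t t1; [exists t2; rewrite tE | exists t1].
Qed.

(** [p] is the corner whose spin occurs once on the face. The bichromatic sides are those at [p];
    the third corner [r] may lie outside the box. *)
Lemma odd_corner N sigma t : crossed N sigma t -> exists p q r,
  [/\ [/\ p != q, p != r & q != r], corners t = [fset p; q; r]%fset,
    sigma p != sigma q, sigma q = sigma r & box N p /\ box N q].
Proof.
case=> [u [v [ut vt [uB vB suv]]]].
have uv : u != v by apply: contraNneq suv => ->.
have [w [wu wv tE]] := corners_third ut vt uv.
have [sw|sw] := eqVneq (sigma v) (sigma w).
  by exists u, v, w; split=> //; split=> //; rewrite eq_sym.
exists v, u, w; split=> //; first by split=> //; rewrite eq_sym.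
- by rewrite tE; apply/fsetP => z; rewrite !inE [(z == u) || _]orbC.
- by rewrite eq_sym.
- by move: sw suv; case: (sigma u) (sigma v) (sigma w) => [] [] [].
Qed.

Definition inner N t := `[< forall u, u \in corners t -> box N u >].

(** Each of the two sides at the odd corner leads to exactly one further face, provided that it lies
    in the box. The side [pq] always does, the side [pr] only when the whole face does. *)
Lemma link_degree N sigma (x : crossed_type N sigma) :
  #|link x| = (1 + inner N (val x))%N.
Proof.
have [p [q [r [[pq pr qr] xE spq sqr [pB qB]]]]] := odd_corner (crossed_val x).
have px : p \in corners (val x) by rewrite xE !inE eqxx.
have qx : q \in corners (val x) by rewrite xE !inE eqxx orbT.
have rx : r \in corners (val x) by rewrite xE !inE eqxx orbT.
have innerE : inner N (val x) = `[< box N r >].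
  apply/asboolP/asboolP => [|rB u]; first exact.
  by rewrite xE !inE => /orP[/orP[]|] /eqP->.
have linkE y : link x y -> x != y /\ p \in corners (val y) /\
    (q \in corners (val y) \/ box N r /\ r \in corners (val y)).
  case/andP => xy /asboolP[u [v [+ + uy vy [uB vB suv]]]].
  rewrite xE !inE => /orP[/orP[]|]/eqP uE /orP[/orP[]|]/eqP vE; subst u v; split=> //;
    rewrite ?sqr ?eqxx // in suv; split=> //; by [left | right].
have face (s : hexagon) : s \in corners (val x) -> p != s -> box N s ->
    sigma p != sigma s -> exists y : crossed_type N sigma,
    [/\ link x y, p \in corners (val y) & s \in corners (val y)].
  move=> sx ps sB sps; have [t [xt pt st]] := other_face px sx ps.
  have tW : crossed N sigma t by exists p, s.
  have [y yE] := crossed_typeP tW; exists y; rewrite yE; split=> //.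
  apply/andP; split; first by apply: contraNneq xt => ->; rewrite yE.
  by apply/asboolP; exists p, s; rewrite yE.
have uniq_face (s : hexagon) (y y' : crossed_type N sigma) : s \in corners (val x) -> p != s ->
    x != y -> x != y' -> p \in corners (val y) -> s \in corners (val y) ->
    p \in corners (val y') -> s \in corners (val y') -> y' = y.
  move=> sx ps xy xy' py sy py' sy'; apply: val_inj.
  have [yE|//] := faces_of_edge ps px sx py sy py' sy' xy.
  by move: xy'; rewrite -(inj_eq val_inj) yE eqxx.
have [y1 [xy1 py1 qy1]] := face q qx pq qB spq.
rewrite innerE; have [rB|rB] := asboolP (box N r).
  have [y2 [xy2 py2 ry2]] := face r rx pr rB (ltac:(by rewrite -sqr)).
  have y12 : y1 != y2.
    have /andP[nxy1 _] := xy1.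
    apply: contraNneq nxy1 => y12; apply/eqP/val_inj/corners_inj/eqP.
    rewrite eqEfcard !card_corners leqnn andbT xE; apply/fsubsetP => z.
    by rewrite !inE => /orP[/orP[]|]/eqP->; rewrite // y12.
  have u : uniq [:: y1; y2] by rewrite /= inE y12.
  rewrite -[RHS]/(size [:: y1; y2]) -(card_uniqP u); apply: eq_card => y.
  rewrite unfold_in !inE; apply/idP/idP => [|/orP[]/eqP->//].
  case/andP: (xy1) (xy2) => nxy1 _ /andP[nxy2 _].
  move=> /linkE[xy [py [qy|[_ ry]]]].
    by rewrite (uniq_face q y1 y) ?eqxx.
  by rewrite (uniq_face r y2 y) ?eqxx ?orbT.
transitivity #|pred1 y1|; last by rewrite card1.
apply: eq_card => y; rewrite unfold_in !inE.
apply/idP/eqP => [|->//]; case/andP: (xy1) => nxy1 _.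
by move=> /linkE[xy [py [qy|[]//]]]; exact: (uniq_face q).
Qed.

(** * Cardinals of finite sets *)

Lemma card_set_seq (T : choiceType) (s : seq T) : uniq s -> Defs.card [set` s] = size s.
Proof.
move=> us; rewrite /Defs.card; have -> : fset_set [set` s] = [fset y in s]%fset.
  apply/fsetP => y; rewrite in_fset_set; last by apply/finite_seqP; exists s.
  by rewrite !inE; apply/idP/idP; rewrite inE.
by rewrite card_fseq undup_id.
Qed.

Lemma card_bij (T : choiceType) (F : finType) (P : pred F) (h : F -> T) (S : set T) :
  (forall x, P x -> S (h x)) -> {in P &, injective h} ->
  (forall s, S s -> exists2 x, P x & h x = s) -> finite_set S /\ Defs.card S = #|P|.
Proof.
move=> hS hinj hsurj; pose s := [seq h x | x in P].
have SE : S = [set` s].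
  apply/seteqP; split=> [y /hsurj[x Px <-]|y /= /mapP[x]].
    by apply: map_f; rewrite mem_enum.
  by rewrite mem_enum => Px ->; exact: hS.
have fS : finite_set S by apply/finite_seqP; exists s.
split=> //; rewrite SE card_set_seq ?size_map ?cardE // map_inj_in_uniq ?enum_uniq //.
by move=> x y; rewrite !mem_enum; exact: hinj.
Qed.

Lemma card_setID (T : choiceType) (S A : set T) : finite_set S ->
  Defs.card S = (Defs.card (S `&` A) + Defs.card (S `\` A))%N.
Proof.
move=> fS; rewrite /Defs.card -[in LHS](setUIDK S A) fset_setU; last 2 first.
- exact: finite_setIl.
- exact: finite_setD.
rewrite cardfsU; set X := (_ `&` _)%fset.
suff -> : X = fset0 by rewrite cardfs0 subn0.
apply/fsetP => x; rewrite !inE !in_fset_set; [|exact: finite_setD|exact: finite_setIl].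
by apply/negbTE/negP => /andP[/set_mem[_ Ax] /set_mem[_]].
Qed.

(** * Loops as cyclic interfaces *)

Definition box_edges N : set hedge := [set e | forall u, borders e u -> box N u].

Lemma borders2 t t' u : borders [fset t; t']%fset u <-> u \in corners t /\ u \in corners t'.
Proof.
split=> [H|[ut ut'] f]; first by split; apply: H; rewrite !inE eqxx ?orbT.
by rewrite !inE => /orP[]/eqP->.
Qed.

Lemma link_atP N sigma t t' : (t != t' /\ link_at N sigma t t') <->
  (loops_of sigma [fset t; t']%fset /\ box_edges N [fset t; t']%fset).
Proof.
split=> [[tt' [u [v [ut vt ut' vt' [uB vB suv]]]]]|[[tt' [u [v [uE vE suv]]]] EB]].
  have uv : u != v by apply: contraNneq suv => ->.
  split.
    split; first by exists t, t'; split=> //; exact: common_corners_hadj uv _ _ _ _.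
    by exists u, v; split=> //; apply/borders2.
  move=> w /borders2[wt wt'].
  have : w \in (corners t `&` corners t')%fset by rewrite inE wt.
  by rewrite (corners_meet tt' uv) // !inE => /orP[]/eqP->.
split.
  have [f [g [fg E]]] := tt'; apply/negP => /eqP tE.
  have /hadjP[_ [_ [_ + _]]] := fg.
  have : #|` [fset t; t']%fset| = #|` [fset f; g]%fset| by rewrite E.
  by rewrite tE !cardfs2 eqxx => /eqP; case: (f != g).
have [ut ut'] := (borders2 _ _ _).1 uE; have [vt vt'] := (borders2 _ _ _).1 vE.
by exists u, v; split=> //; split=> //; exact: EB.
Qed.

Section LoopsInBox.
Variables (N : nat) (sigma : spin_config).
Let W := crossed_type N sigma.
Notation lk := (@link N sigma).

Definition loops_in_box := [set C : subgraph |
  [/\ is_loop C, C `<=` loops_of sigma & C `<=` box_edges N]].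

Lemma link_edge (x y : W) : lk x y <->
  (loops_of sigma [fset val x; val y]%fset /\ box_edges N [fset val x; val y]%fset).
Proof.
rewrite -link_atP /link -(inj_eq val_inj); split=> [/andP[xy /asboolP]//|[-> xy]].
exact/asboolP.
Qed.

Definition component_edges (r : W) : subgraph := [set e | exists x y : W,
  [/\ connect lk r x, lk x y & e = [fset val x; val y]%fset]].

Lemma link_deg_le2 (x : W) : (#|lk x| <= 2)%N.
Proof. by rewrite link_degree; case: inner. Qed.

Lemma component_edges_cycle r (c : seq W) : ucycle lk c -> (2 < size c)%N ->
  connect lk r =i c -> component_edges r =
  [set e | exists2 f, f \in map val c & e = [fset f; next (map val c) f]%fset].
Proof.
move=> uc szc rc; have /andP[cc uc'] := uc.
apply/seteqP; split=> [e [x [y [rx xy ->]]]|e [f /mapP[x xc ->] ->]].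
  have xc : x \in c by rewrite -rc.
  case: (ucycle_neighbors (@link_sym N sigma) link_deg_le2 uc szc xc xy) => ->.
    by exists (val x); rewrite ?map_f // (next_map val_inj uc').
  exists (val (prev c x)); rewrite ?map_f ?mem_prev //.
  by rewrite (next_map val_inj uc') next_prev // fsetUC.
rewrite (next_map val_inj uc'); exists x, (next c x); split=> //; last exact: next_cycle.
by rewrite -[connect _ _ _]/(x \in connect lk r) rc.
Qed.

Lemma component_edges_inj (r r' : W) : roots lk r -> roots lk r' ->
  component_edges r `&` component_edges r' !=set0 -> r = r'.
Proof.
have ls := sym_connect_sym (@link_sym N sigma).
move=> /eqP rr /eqP rr' [e [[x [y [rx xy ->]]] [x' [y' [rx' xy' E]]]]].
rewrite -rr -rr'; apply/eqP; rewrite root_connect //; apply: connect_trans rx _.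
rewrite ls; apply: connect_trans rx' _.
have /fsetP/(_ (val x)) := E; rewrite !inE eqxx /= => /esym/orP[]/eqP/val_inj->//.
exact: connect1.
Qed.

(** A loop already uses two neighbours of each of its vertices, the most the interface graph allows,
    so nothing can be attached to it: it is a whole component. *)
Lemma loops_in_box_component C : loops_in_box C ->
  exists2 r, roots lk r && cyclic_component lk r & component_edges r = C.
Proof.
have ls := sym_connect_sym (@link_sym N sigma).
move=> [[c [cc szc CE]] Csig CB].
have cadj f : f \in c -> f != next c f /\ link_at N sigma f (next c f).
  move=> fc; apply/link_atP.
  by split; [apply: Csig | apply: CB]; rewrite CE /=; exists f.
have [cW cWE] : exists cW : seq W, map val cW = c.
  have : forall f, f \in c -> crossed N sigma f.
    by move=> f /cadj[_ [u [v [uf vf _ _ uv]]]]; exists u, v.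
  elim: (c) => [_|f s IHs fs]; first by exists [::].
  have [|s' sE] := IHs; first by move=> g gs; apply: fs; rewrite inE gs orbT.
  have [x xE] := crossed_typeP (fs f (mem_head _ _)).
  by exists (x :: s'); rewrite /= sE xE.
subst c; rewrite size_map in szc.
have ucW : uniq cW by case/andP: cc => _; rewrite map_inj_uniq //; exact: val_inj.
have cl : ucycle lk cW.
  rewrite /ucycle ucW andbT; apply: (@sub_in_cycle _ (mem cW) (frel (next cW)) lk) (cycle_next ucW).
    move=> x _ xc _ /eqP <-; have [] := cadj (val x) (map_f _ xc).
    by rewrite (next_map val_inj ucW) => xn xl; apply/andP; split; [rewrite -(inj_eq val_inj) | apply/asboolP].
  exact/allP.
have [x0 x0c] : exists x0, x0 \in cW.
  by case: (cW) szc => // x s _; exists x; rewrite mem_head.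
have conn : connect lk x0 =i cW.
  move=> x; apply/idP/idP.
    move=> /connectP[p + ->]; elim: p (x0) x0c => //= y p IHp z zc /andP[zy].
    apply: IHp; case: (ucycle_neighbors (@link_sym N sigma) link_deg_le2 cl szc zc zy) => ->.
      by rewrite mem_next.
    by rewrite mem_prev.
  have [i s E] := rot_to x0c; rewrite -(mem_rot i) E => xs.
  have : cycle lk (rot i cW) by rewrite rot_cycle; case/andP: cl.
  rewrite E /= rcons_path => /andP[/path_connect + _]; exact.
have rc : connect lk (fingraph.root lk x0) =i cW.
  move=> x; rewrite -conn; apply/esym/(same_connect ls); exact: connect_root.
exists (fingraph.root lk x0).
  rewrite roots_root //; apply/forallP => x; apply/implyP => rx.
  by apply: (ucycle_degree (@link_sym N sigma) cl szc); rewrite -rc.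
by rewrite (component_edges_cycle cl szc rc) CE.
Qed.

(** Loops sharing an edge are one and the same component, so a given edge lies on at most one
    loop. *)
Lemma loops_in_box_eq C C' : loops_in_box C -> loops_in_box C' ->
  C `&` C' !=set0 -> C = C'.
Proof.
move=> /loops_in_box_component[r /andP[rr _] <-].
move=> /loops_in_box_component[r' /andP[rr' _] <-].
by move=> /(component_edges_inj rr rr') ->.
Qed.

Lemma card_loops_in_box : finite_set loops_in_box /\
  Defs.card loops_in_box = #|[pred r | roots lk r & cyclic_component lk r]|.
Proof.
apply: (card_bij (h := component_edges)).
- move=> r /andP[rr rcyc].
  have [c [uc szc rc]] := cyclic_component_ucycle (@link_sym N sigma)
    (@link_irr N sigma) link_deg_le2 rcyc.
  have rE e : component_edges r e -> loops_of sigma e /\ box_edges N e.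
    by move=> [x [y [_ /link_edge xy ->]]].
  split; [|by move=> e /rE[]|by move=> e /rE[]].
  exists (map val c); split; rewrite ?size_map ?(component_edges_cycle uc) //.
  have /andP[cc uc'] := uc; rewrite /ucycle map_inj_uniq ?uc' //.
  rewrite andbT cycle_map; apply: sub_cycle cc => x y.
  move=> /andP[xy /asboolP[u [v [ux vx uy vy [_ _ suv]]]]].
  by apply: (common_corners_hadj _ _ ux vx uy vy) => //; apply: contraNneq suv => ->.
- move=> r r'; rewrite !inE => /andP[rr rcyc] /andP[rr' _] E; apply: component_edges_inj => //.
  rewrite -E setIid.
  have : (0 < #|lk r|)%N by rewrite link_degree.
  move=> /card_gt0P[y ry]; exists [fset val r; val y]%fset, r, y.
  by split=> //; exact: connect0.
- exact: loops_in_box_component.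
Qed.
End LoopsInBox.

(** * Independence of the configuration inside G *)

Definition agree_off (G : set hexagon) (sigma sigma' : spin_config) :=
  forall u, ~ G u -> sigma u = sigma' u.

Lemma agree_offC G sigma sigma' : agree_off G sigma sigma' -> agree_off G sigma' sigma.
Proof. by move=> H u /H. Qed.

Definition closed_hull (G : set hexagon) := G `|` neighborhood G.

(* The faces through which interfaces leave the box. *)
Definition ends N sigma : set hvertex := [set t | crossed N sigma t /\ ~ inner N t].

Lemma card_ends N sigma : Defs.card (ends N sigma) =
  #|[pred x | #|@link N sigma x| == 1%N]|.
Proof.
have [|||//] := @card_bij _ _ [pred x | #|@link N sigma x| == 1%N] val (ends N sigma).
- move=> x /=; rewrite link_degree eqSS eqb0 => /negP nx.
  by split=> //; exact: crossed_val.
- by move=> x y _ _; exact: val_inj.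
- move=> t [/crossed_typeP[x <-] xN]; exists x => //=.
  by rewrite link_degree eqSS eqb0; apply/negP.
Qed.

Lemma double_clusters_in_box N sigma : (n_comp (@mono N sigma) predT).*2 =
  ((Defs.card (loops_in_box N sigma)).*2 + Defs.card (ends N sigma) + 2)%N.
Proof.
rewrite n_comp_mono_link doubleS (double_n_comp (@link_sym N sigma)).
- by rewrite (card_loops_in_box N sigma).2 card_ends addn2.
- exact: link_irr.
- exact: link_deg_le2.
- by move=> x; rewrite link_degree.
Qed.

Lemma loops_of_agree_off G sigma sigma' : agree_off G sigma sigma' ->
  loops_of sigma `\` bordering_edges G = loops_of sigma' `\` bordering_edges G.
Proof.
suff sub s s' : agree_off G s s' ->
    loops_of s `\` bordering_edges G `<=` loops_of s' `\` bordering_edges G.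
  by move=> ss'; apply/seteqP; split; apply: sub => //; exact: agree_offC.
move=> ss' e [[eH [u [v [eu ev suv]]]] eG]; split=> //; split=> //.
exists u, v; split=> //; rewrite -!ss' // => Gu; apply: eG; split=> //.
  by exists v.
by exists u.
Qed.

(** The corners of a face that meets [G] belong to [G] or its neighborhood. A face sticking out of
    the box therefore avoids [G], and its spins are common to both configurations. *)
Lemma ends_agree_off N G sigma sigma' : agree_off G sigma sigma' ->
  closed_hull G `<=` box N -> ends N sigma = ends N sigma'.
Proof.
move=> + GN.
suff sub s s' : agree_off G s s' -> ends N s `<=` ends N s'.
  by move=> ss'; apply/seteqP; split; apply: sub => //; exact: agree_offC.
move=> ss' t [[u [v [ut vt [uB vB suv]]]] tN].
have tG w : w \in corners t -> ~ G w.
  move=> wt Gw; apply: tN; apply/asboolP => z zt; apply: GN.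
  have [->|zw] := eqVneq z w; first by left.
  by right; exists w => //; apply: corners_tadj wt zt _; rewrite eq_sym.
split=> //; exists u, v; split=> //; split=> //.
by rewrite -!ss' //; exact: tG.
Qed.

Definition touching (Omega : set hedge) : set subgraph := [set C | C `&` Omega !=set0].

Lemma outer_loops_agree_off N G sigma sigma' : agree_off G sigma sigma' ->
  loops_in_box N sigma `\` touching (bordering_edges G) =
  loops_in_box N sigma' `\` touching (bordering_edges G).
Proof.
suff sub s s' : agree_off G s s' ->
    loops_in_box N s `\` touching (bordering_edges G) `<=` loops_in_box N s'.
  move=> ss'; apply/seteqP.
  by split=> C [CL Ct]; split=> //; [apply: (sub sigma) | apply: (sub sigma') => //; exact: agree_offC].
move=> ss' C [[Cl Cs CB] Ct]; split=> // e Ce.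
have : (loops_of s `\` bordering_edges G) e.
  by split; [exact: Cs | move=> eG; apply: Ct; exists e].
by rewrite (loops_of_agree_off ss') => -[].
Qed.

Lemma card_loops_in_box_split N Omega sigma :
  (forall C, is_loop C -> C `<=` loops_of sigma -> C `&` Omega !=set0 ->
    C `<=` box_edges N) ->
  Defs.card (loops_in_box N sigma) = (num_loops Omega (loops_of sigma) +
    Defs.card (loops_in_box N sigma `\` touching Omega))%N.
Proof.
move=> big; rewrite [LHS](card_setID (touching Omega) (card_loops_in_box _ _).1).
congr (Defs.card _ + _)%N; apply/seteqP; split=> C.
  by move=> [[Cl Cs _] Ct].
by move=> [Cl Cs Ct]; split=> //; split=> //; exact: big.
Qed.

(** * Clusters in the plane and in the box *)

Lemma connected_in_refl (A : set hexagon) u : A u -> connected_in A u u.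
Proof. by move=> Au; exists [::]; split=> // w; rewrite inE => /eqP->. Qed.

Lemma connected_in_trans (A : set hexagon) u v w :
  connected_in A u v -> connected_in A v w -> connected_in A u w.
Proof.
move=> [p [up vE pA]] [q [vq wE qA]]; exists (p ++ q); split.
- by rewrite cat_path up vE.
- by rewrite last_cat vE.
- move=> z; rewrite -cat_cons mem_cat => /orP[/pA//|zq].
  by apply: qA; rewrite inE zq orbT.
Qed.

Lemma connected_in_sym (A : set hexagon) u v : connected_in A u v -> connected_in A v u.
Proof.
move=> [p [up vE pA]]; exists (rev (belast u p)); split.
- rewrite -vE rev_path; apply: sub_path up => x y; by rewrite tadj_sym.
- case: p {up pA} vE => //= x p _; by rewrite rev_cons last_rcons.
- move=> w; rewrite -vE -rev_rcons -lastI mem_rev; exact: pA.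
Qed.

(** Referring to the spin of [u] treats plus and minus clusters together. *)
Definition same_cluster (sigma : spin_config) u v :=
  connected_in [set w | sigma w = sigma u] u v.

Lemma same_cluster_spin sigma u v : same_cluster sigma u v -> sigma v = sigma u.
Proof. by move=> [p [_ <- pA]]; apply: pA; exact: mem_last. Qed.

Lemma same_clusterC sigma u v : same_cluster sigma u v -> same_cluster sigma v u.
Proof.
by move=> uv; rewrite /same_cluster (same_cluster_spin uv); exact: connected_in_sym.
Qed.

Lemma same_cluster_trans sigma u v w : same_cluster sigma u v ->
  same_cluster sigma v w -> same_cluster sigma u w.
Proof.
move=> uv; rewrite /same_cluster (same_cluster_spin uv).
exact: connected_in_trans.
Qed.

Lemma connect_same_cluster N sigma (x y : box_type N) :
  connect (@mono N sigma) x y -> same_cluster sigma (val x) (val y).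
Proof.
move=> /connectP[p + ->]; elim: p x => [|z p IHp] x /=.
  by move=> _; exact: connected_in_refl.
move=> /andP[/andP[xz /eqP sxz] /IHp]; apply: same_cluster_trans.
exists [:: val z]; split=> //=; first by rewrite xz.
by move=> w; rewrite !inE => /orP[]/eqP-> /=.
Qed.

Lemma path_connect_box N sigma (x y : box_type N) p :
  path tadj (val x) p -> last (val x) p = val y ->
  (forall w, w \in val x :: p -> sigma w = sigma (val x) /\ box N w) ->
  connect (@mono N sigma) x y.
Proof.
elim: p x => [|z p IHp] x /=; first by move=> _ /val_inj->.
move=> /andP[xz zp] yE pB.
have [|sz zB] := pB z; first by rewrite !inE eqxx orbT.
have [z' zE] := box_typeP zB; subst z.
apply: (@connect_trans _ _ z').
  by apply: connect1; rewrite /mono xz sz /=.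
apply: IHp => // w wp; rewrite sz; apply: pB.
by rewrite inE wp orbT.
Qed.

Definition meets_hull N sigma G (x : box_type N) :=
  `[< exists2 y, closed_hull G (val y) & connect (@mono N sigma) x y >].

(** Restriction to the box may break a cluster into pieces. This asks that at most one piece of each
    cluster meets the hull. *)
Definition hull_connected N sigma G := forall x y : box_type N,
  closed_hull G (val x) -> closed_hull G (val y) ->
  same_cluster sigma (val x) (val y) -> connect (@mono N sigma) x y.

Lemma card_touching_clusters N sigma G : closed_hull G `<=` box N ->
  hull_connected N sigma G ->
  (num_clusters G [set u | sigma u] + num_clusters G [set u | ~~ sigma u])%N =
  #|[pred r | roots (@mono N sigma) r & meets_hull sigma G r]|.
Proof.
move=> GN conn; set P := [pred r | _ & _].
have ms := sym_connect_sym (@mono_sym N sigma).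
pose S : set (set hexagon) := [set C | (exists u, C = [set v | same_cluster sigma u v]) /\
  C `&` closed_hull G !=set0].
have [|||fS <-] := @card_bij _ _ P (fun r => [set v | same_cluster sigma (val r) v]) S.
- move=> r /andP[_ /asboolP[y yG ry]]; split; first by exists (val r).
  by exists (val y); split=> //; exact: connect_same_cluster ry.
- move=> r r'; rewrite !inE => /andP[/eqP rr /asboolP[y yG ry]].
  move=> /andP[/eqP rr' /asboolP[y' yG' ry']] /seteqP[E _].
  rewrite -rr -rr'; apply/eqP; rewrite root_connect //.
  apply: (connect_trans ry); rewrite ms; apply: (connect_trans ry'); rewrite ms.
  apply: conn => //; have := E _ (connect_same_cluster ry) => /same_clusterC /same_cluster_trans.
  by apply; exact: connect_same_cluster.
- move=> C [[u ->] [v [uv vG]]]; have [x xE] := box_typeP (GN _ vG).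
  exists (fingraph.root (@mono N sigma) x).
    rewrite inE /= roots_root //; apply/asboolP; exists x; first by rewrite xE.
    by rewrite ms connect_root.
  have rx := connect_same_cluster (connect_root (@mono N sigma) x).
  apply/seteqP; split=> w /= vw.
    apply: same_cluster_trans uv _; rewrite -xE; exact: same_cluster_trans rx vw.
  apply: same_cluster_trans (same_clusterC rx) _; rewrite xE.
  exact: same_cluster_trans (same_clusterC uv) vw.
(* The clusters in [S] are sorted by spin: the plus clusters are those containing a site of spin
   +1. *)
rewrite /num_clusters (card_setID [set C | exists2 u, C u & sigma u] fS); congr (_ + _)%N; congr (Defs.card _).
  apply/seteqP; split=> C.
    move=> [[u su ->] CG]; split; last first.
      by exists u => //=; exact: connected_in_refl.
    split=> //; exists u; apply/seteqP; split=> v /=; rewrite /same_cluster.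
      by have -> : [set w | sigma w = sigma u] = [set w | sigma w] by rewrite su.
    by have -> : [set w | sigma w = sigma u] = [set w | sigma w] by rewrite su.
  move=> [[[u CE] CG] [v Cv sv]]; split=> //; exists u.
    by move: Cv; rewrite CE => /same_cluster_spin /= <-.
  have su : sigma u by move: Cv; rewrite CE => /same_cluster_spin <-.
  rewrite CE /same_cluster.
  by have -> : [set w | sigma w = sigma u] = [set w | sigma w] by rewrite su.
apply/seteqP; split=> C.
  move=> [[u su CE] CG].
  have sE : [set w | ~~ sigma w] = [set w | sigma w = sigma u].
    by apply/seteqP; split=> w /=; move: su => /= /negPf ->; [move/negPf|move=> ->].
  split; first by split=> //; exists u; rewrite CE sE.
  case=> v; rewrite CE /= => -[p [_ <- pA]] sv.
  by have := pA _ (mem_last _ _); rewrite /= sv.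
move=> [[[u CE] CG] CnS]; split=> //.
have su : ~~ sigma u.
  apply/negP => su; apply: CnS; exists u => //; rewrite CE /=; exact: connected_in_refl.
have sE : [set w | ~~ sigma w] = [set w | sigma w = sigma u].
  by apply/seteqP; split=> w /=; move: su => /= /negPf ->; [move/negPf|move=> ->].
by exists u => //; rewrite CE sE.
Qed.

Lemma n_comp_mono_split N sigma G : n_comp (@mono N sigma) predT =
  (#|[pred r | roots (@mono N sigma) r & meets_hull sigma G r]| +
   #|[pred r | roots (@mono N sigma) r & ~~ meets_hull sigma G r]|)%N.
Proof.
rewrite /n_comp_mem -(cardID [pred r | meets_hull sigma G r]); congr (_ + _)%N.
  by apply: eq_card => r; rewrite !inE andbT.
by apply: eq_card => r; rewrite !inE andbT andbC.
Qed.

(** A component avoiding the hull contains no site of [G] and no neighbour of one, so changing spins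
    in [G] neither breaks it nor lets it grow. Growth is what the neighborhood in the hull
    prevents. *)
Lemma connect_off_hull N sigma sigma' G (x : box_type N) : agree_off G sigma sigma' ->
  ~~ meets_hull sigma G x -> connect (@mono N sigma) x =1 connect (@mono N sigma') x.
Proof.
move=> ss' xG.
have off y : connect (@mono N sigma) x y -> ~ closed_hull G (val y).
  by move=> xy yG; move/asboolP: xG; apply; exists y.
have eqG y : connect (@mono N sigma) x y -> sigma (val y) = sigma' (val y).
  by move=> /off yG; apply: ss' => Gy; apply: yG; left.
move=> y; apply/idP/idP.
  move=> /connectP[p + ->]; elim/last_ind: p {y} => [|p z IHp].
    by move=> _; exact: connect0.
  rewrite rcons_path last_rcons => /andP[xp lz].
  have xl : connect (@mono N sigma) x (last x p) by apply/connectP; exists p.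
  have xz := connect_trans xl (connect1 lz).
  apply: connect_trans (IHp xp) (connect1 _).
  by case/andP: lz => lz slz; rewrite /mono lz -!eqG.
move=> /connectP[p + ->]; elim/last_ind: p {y} => [|p z IHp].
  by move=> _; exact: connect0.
rewrite rcons_path last_rcons => /andP[/IHp xl /andP[lz slz]].
apply: (connect_trans xl (connect1 _)); rewrite /mono lz (eqG _ xl) (eqP slz) eq_sym.
apply/eqP/ss' => Gz; apply: off xl _; right; exists (val z) => //.
by rewrite tadj_sym.
Qed.

Lemma card_off_hull_agree N G sigma sigma' : agree_off G sigma sigma' ->
  #|[pred r | roots (@mono N sigma) r & ~~ meets_hull sigma G r]| =
  #|[pred r | roots (@mono N sigma') r & ~~ meets_hull sigma' G r]|.
Proof.
suff sub s s' : agree_off G s s' -> subpred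
    [pred r | roots (@mono N s) r & ~~ meets_hull s G r]
    [pred r | roots (@mono N s') r & ~~ meets_hull s' G r].
  move=> ss'; apply: eq_card => r.
  by apply/idP/idP; apply: sub => //; exact: agree_offC.
move=> ss' r /andP[/eqP rr rG]; have E := connect_off_hull ss' rG.
apply/andP; split.
  (* A root is picked from the connectivity predicate alone, so equal components have equal
     roots. *)
  by apply/eqP; rewrite -[RHS]rr /fingraph.root; congr (odflt _ _); apply: eq_pick => y; rewrite E.
apply: contraNN rG => /asboolP[y yG ry]; apply/asboolP; exists y => //.
by rewrite E.
Qed.

(** * Boxes that are large enough *)

Lemma bordering_edges_finite G : finite_set G -> finite_set (bordering_edges G).
Proof.
move=> /faces_finite fG.
apply: (@sub_finite_set _ _ ((fun p : hvertex * hvertex => [fset p.1; p.2]%fset) @`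
    (faces G `*` faces G))).
  move=> e [[f [g [_ eE]]] [u Gu eu]]; exists (f, g); last by rewrite eE.
  by split; exists u => //; apply: eu; rewrite eE !inE eqxx ?orbT.
exact/finite_image/finite_setX.
Qed.

Lemma closed_hull_finite G : finite_set G -> finite_set (closed_hull G).
Proof.
move=> /finite_in_box[N /(_ _ (leqnn N)) GN].
apply: (sub_finite_set _ (box_finite N.+1)) => v [/GN|[u /GN]].
  by rewrite /box /=; lia.
by rewrite tadjE /box /=; lia.
Qed.

(** The hull has finitely many pairs of points, and one finite path per connected pair has to fit
    into the box. *)
Lemma hull_connected_eventually sigma G : finite_set G ->
  exists N, forall M, (N <= M)%N -> hull_connected M sigma G.
Proof.
move=> fG; pose P M (p : hexagon * hexagon) := forall x y : box_type M,
  val x = p.1 -> val y = p.2 -> same_cluster sigma p.1 p.2 -> connect (@mono M sigma) x y.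
have [|[u v] _|N NP] := @uniform_bound _ (closed_hull G `*` closed_hull G) P.
- by apply: finite_setX; exact: closed_hull_finite.
- have [uv|nuv] := pselect (same_cluster sigma u v); last by exists 0%N => M _ x y /= _ _.
  have [p [up vE pA]] := uv.
  have [|N NP] := @finite_in_box [set` u :: p]; first by apply/finite_seqP; exists (u :: p).
  exists N => M NM x y /= xE yE _; subst u.
  by apply: (path_connect_box up (etrans vE (esym yE))) => w wp; split; [exact: pA | exact: NP].
exists N => M NM x y xG yG; exact: (NP M NM (val x, val y)).
Qed.

Lemma is_loop_in_box C : is_loop C ->
  exists N, forall M, (N <= M)%N -> C `<=` box_edges M.
Proof.
move=> [c [_ _ CE]]; pose s : seq hexagon := flatten [seq enum_fset (corners f) | f <- c].
have [|N NP] := @finite_in_box [set` s]; first by apply/finite_seqP; exists s.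
exists N => M NM e; rewrite CE => -[f fc ->] u uf; apply: (NP M NM).
apply/flattenP; exists (enum_fset (corners f)); first by apply: map_f.
by apply: uf; rewrite !inE eqxx.
Qed.

Lemma loops_in_box_eventually sigma G : finite_set G ->
  exists N, forall M, (N <= M)%N -> forall C, is_loop C -> C `<=` loops_of sigma ->
    C `&` bordering_edges G !=set0 -> C `<=` box_edges M.
Proof.
move=> /bordering_edges_finite fO.
pose P M e := forall C, is_loop C -> C `<=` loops_of sigma -> C e -> C `<=` box_edges M.
have [e _|N NP] := @uniform_bound _ _ P fO; last first.
  by exists N => M NM C Cl Cs [e [Ce eO]]; apply: (NP M NM e).
have [[C [Cl Cs Ce]]|noC] := pselect (exists C, [/\ is_loop C, C `<=` loops_of sigma & C e]).
  have [N NP] := is_loop_in_box Cl; exists N => M NM C' C'l C's C'e.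
  have [N' N'P] := is_loop_in_box C'l.
  (* The threshold comes from one loop [C] through [e]. Any other loop through [e] is compared with
     [C] in a box containing both, where they coincide. *)
  suff -> : C' = C by exact: NP.
  apply: (@loops_in_box_eq (maxn N N') sigma).
  - by split=> //; apply: N'P; exact: leq_maxr.
  - by split=> //; apply: NP; exact: leq_maxl.
  - by exists e.
by exists 0%N => M _ C Cl Cs Ce; case: noC; exists C.
Qed.

(** Write the doubled identity for both configurations in a common box and subtract: clusters off
    the hull, outer loops and ends cancel. *)
Lemma spin_k_sub_num_loops G sigma sigma' : finite_set G -> agree_off G sigma sigma' ->
  spin_k G sigma - (num_loops (bordering_edges G) (loops_of sigma))%:Z =
  spin_k G sigma' - (num_loops (bordering_edges G) (loops_of sigma'))%:Z.
Proof.
move=> fG ss'.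
have [N1 H1] := finite_in_box (closed_hull_finite fG).
have [N2 H2] := hull_connected_eventually sigma fG.
have [N3 H3] := hull_connected_eventually sigma' fG.
have [N4 H4] := loops_in_box_eventually sigma fG.
have [N5 H5] := loops_in_box_eventually sigma' fG.
pose N := (N1 + N2 + N3 + N4 + N5)%N.
have {H1}GN := H1 N ltac:(lia).
have := (double_clusters_in_box N sigma, double_clusters_in_box N sigma').
rewrite !(n_comp_mono_split _ _ G) -(card_off_hull_agree N ss') (ends_agree_off ss' GN).
rewrite -!card_touching_clusters //; [|by apply: H3; lia|by apply: H2; lia].
rewrite (card_loops_in_box_split (H4 N ltac:(lia))).
rewrite (card_loops_in_box_split (H5 N ltac:(lia))).
rewrite (outer_loops_agree_off N ss') /spin_k.
by case; lia.
Qed.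

(** * Loop configurations and spin configurations *)

(* For adjacent [u] and [v], the two endpoints of the edge separating them. *)
Definition dual (u v : hexagon) : hedge :=
  fset_set [set t | u \in corners t /\ v \in corners t].

Lemma mem_dual u v t : t \in dual u v = (u \in corners t) && (v \in corners t).
Proof.
rewrite in_fset_set; first by apply/idP/andP => [/set_mem|/mem_set].
apply: sub_finite_set (faces_finite (finite_set1 u)) => f [uf _].
by exists u.
Qed.

Lemma dualC u v : dual u v = dual v u.
Proof. by apply/fsetP => t; rewrite !mem_dual andbC. Qed.

Lemma dual_faces u v t t' : u != v -> t != t' ->
  u \in corners t -> v \in corners t -> u \in corners t' -> v \in corners t' ->
  dual u v = [fset t; t']%fset.
Proof.
move=> uv tt' ut vt ut' vt'; apply/fsetP => f; rewrite mem_dual !inE.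
apply/andP/orP => [[uf vf]|[]/eqP-> //].
by have [->|->] := faces_of_edge uv ut vt ut' vt' uf vf tt'; [left | right].
Qed.

Lemma dual_edge u v : tadj u v -> graph_edges hadj (dual u v).
Proof.
move=> uv; have [t [t' [tt' ut vt ut' vt']]] := tadj_faces uv.
have nuv : u != v by move: uv; rewrite tadjE => /andP[].
exists t, t'; split; last exact: dual_faces.
exact: common_corners_hadj nuv _ _ _ _.
Qed.

Lemma graph_edges_dual e : graph_edges hadj e -> exists u v, tadj u v /\ e = dual u v.
Proof.
move=> [t [t' [/hadjP[u [v [uv tt' /fsetP E]]] ->]]].
have /andP[ut ut'] : (u \in corners t) && (u \in corners t').
  by have := E u; rewrite !inE eqxx.
have /andP[vt vt'] : (v \in corners t) && (v \in corners t').
  by have := E v; rewrite !inE eqxx orbT.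
exists u, v; split; first exact: corners_tadj ut vt uv.
by rewrite (dual_faces uv tt').
Qed.

Lemma borders_dual u v w : tadj u v -> borders (dual u v) w <-> w = u \/ w = v.
Proof.
move=> uv; split; last by move=> [->|->] t; rewrite mem_dual => /andP[].
have [t [t' [tt' ut vt ut' vt']]] := tadj_faces uv.
have nuv : u != v by move: uv; rewrite tadjE => /andP[].
rewrite (dual_faces nuv tt') // => /borders2[wt wt'].
have : w \in (corners t `&` corners t')%fset by rewrite inE wt.
by rewrite (corners_meet tt' nuv) // !inE => /orP[]/eqP; [left | right].
Qed.

Lemma loops_of_dual sigma u v : tadj u v ->
  loops_of sigma (dual u v) <-> sigma u != sigma v.
Proof.
move=> uv; split=> [[_ [a [b []]]]|suv].
  move=> /(borders_dual _ uv)[->|->] /(borders_dual _ uv)[->|->]; rewrite ?eqxx //.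
  by rewrite eq_sym.
split; first exact: dual_edge.
by exists u, v; split=> //; apply/(borders_dual _ uv); [left | right].
Qed.

(** The edges at the vertex [t] are dual to the sides of the triangle [t], so even degree at [t] is
    exactly closedness on that face. *)
Lemma odd_degree (omega : subgraph) t p q r : omega `<=` graph_edges hadj ->
  p != q -> p != r -> q != r -> corners t = [fset p; q; r]%fset ->
  odd (Defs.card [set e | omega e /\ t \in e]) =
  `[< omega (dual p q) >] (+) `[< omega (dual q r) >] (+) `[< omega (dual p r) >].
Proof.
move=> oH pq pr qr tE.
have pt : p \in corners t by rewrite tE !inE eqxx.
have qt : q \in corners t by rewrite tE !inE eqxx orbT.
have rt : r \in corners t by rewrite tE !inE eqxx orbT.
have apq := corners_tadj pt qt pq; have apr := corners_tadj pt rt pr.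
have aqr := corners_tadj qt rt qr.
pose s := [:: dual p q; dual q r; dual p r].
have us : uniq s.
  have nd a b c d w : tadj a b -> tadj c d -> (w == a) || (w == b) -> w != c -> w != d ->
      dual a b != dual c d.
    move=> ab cd wab wc wd; apply/negP => /eqP E.
    have /(borders_dual _ cd)[wE|wE] : borders (dual c d) w.
    - by rewrite -E; apply/(borders_dual _ ab); case/orP: wab => /eqP; [left | right].
    - by rewrite wE eqxx in wc.
    - by rewrite wE eqxx in wd.
  rewrite /= !inE negb_or !andbT (nd _ _ _ _ p) ?(nd _ _ _ _ q) ?(nd p q p r q) ?(nd q r p r q) ?eqxx ?orbT //=.
  - by rewrite eq_sym.
  - by rewrite eq_sym.
have -> : [set e | omega e /\ t \in e] = [set` [seq e <- s | `[< omega e >]]].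
  apply/seteqP; split=> e.
    move=> [oe te]; rewrite /mkset mem_filter; apply/andP; split; first exact/asboolP.
    have [u [v [uv eE]]] := graph_edges_dual (oH _ oe); move: te.
    have nuv : u != v by move: uv; rewrite tadjE => /andP[].
    rewrite eE mem_dual tE !inE => /andP[/orP[/orP[]|]/eqP uE /orP[/orP[]|]/eqP vE];
    by subst u v; rewrite ?eqxx // in nuv *; rewrite ?eqxx ?orbT // dualC ?eqxx ?orbT.
  rewrite /mkset mem_filter => /andP[/asboolP oe es]; split=> //.
  by move: es; rewrite !inE => /or3P[]/eqP->; rewrite mem_dual ?pt ?qt ?rt.
rewrite card_set_seq ?filter_uniq //=.
by do 3 case: ifP => _.
Qed.

Lemma loops_of_loop_configuration sigma : loop_configuration (loops_of sigma).
Proof.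
have sub : loops_of sigma `<=` graph_edges hadj by move=> e [].
split=> // t.
have /fset0Pn[p pt] : corners t != fset0 by rewrite -cardfs_gt0 card_corners.
have /fset0Pn[q] : (corners t `\ p)%fset != fset0.
  by rewrite -cardfs_gt0; have := cardfsD1 p (corners t); rewrite card_corners pt add1n => -[<-].
rewrite !inE => /andP[qp qt]; have pq : p != q by rewrite eq_sym.
have [r [rp rq tE]] := corners_third pt qt pq.
have rt : r \in corners t by rewrite tE !inE eqxx orbT.
have pr : p != r by rewrite eq_sym.
have qr : q != r by rewrite eq_sym.
rewrite (odd_degree sub pq pr qr tE).
have E u v : u \in corners t -> v \in corners t -> u != v ->
    `[< loops_of sigma (dual u v) >] = (sigma u != sigma v).
  move=> ut vt uv; have := loops_of_dual sigma (corners_tadj ut vt uv).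
  by move=> H; apply/asboolP/idP => /H.
by rewrite !E //; case: (sigma p) (sigma q) (sigma r) => [] [] [].
Qed.

Lemma loop_configuration_loops_of omega : loop_configuration omega ->
  exists sigma, loops_of sigma = omega.
Proof.
move=> [oH oeven].
pose g u v := (u != v) && `[< omega (dual u v) >].
have gC : cocycle setT g.
  move=> t u v w ut vt wt _ _ _; rewrite /g.
  have [->|uv] := eqVneq u v; first by [].
  have [<-|vw] := eqVneq v w; first by rewrite uv addbF.
  have [<-|uw] := eqVneq u w; first by rewrite dualC addbb.
  rewrite /=.
  have [z [zu zv tE]] := corners_third ut vt uv.
  have wz : w = z.
    by move: wt; rewrite tE !inE => /orP[/orP[]|]/eqP wE //; subst w; rewrite eqxx in uw vw *.
  subst z; have := oeven t; rewrite (odd_degree oH uv uw vw tE).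
  by case: (asbool _) (asbool _) (asbool _) => [] [] [].
have [sigma sE] := triangle_potential gC; exists sigma.
have E u v : tadj u v -> omega (dual u v) <-> loops_of sigma (dual u v).
  move=> uv; have [t [_ [_ ut vt _ _]]] := tadj_faces uv.
  have nuv : u != v by move: uv; rewrite tadjE => /andP[].
  have := sE t u v ut vt; rewrite /g nuv /= => E.
  have H := loops_of_dual sigma uv.
  split=> [/asboolP|/H]; first by rewrite E => suv; apply/H; case: (sigma u) (sigma v) suv => [] [].
  by move=> suv; apply/asboolP; rewrite E; case: (sigma u) (sigma v) suv => [] [].
apply/seteqP; split=> e.
  by move=> es; have [u [v [uv eE]]] := graph_edges_dual es.1; move: es; rewrite eE => /E; exact.
by move=> eo; have [u [v [uv eE]]] := graph_edges_dual (oH _ eo); move: eo; rewrite eE => /E; exact.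
Qed.

Lemma outside_finite (G : set hexagon) : finite_set G -> exists u, ~ G u.
Proof.
move=> /finite_in_box[N /(_ _ (leqnn N)) GN]; exists (N%:Z + 1, 0) => /GN.
by rewrite /box /=; lia.
Qed.

Lemma loops_of_bij G tau : finite_set G -> connected_set (~` G) ->
  set_bij (spin_configs G tau) (loop_configs (bordering_edges G) (loops_of tau)) loops_of.
Proof.
move=> fG GC; have [u0 Gu0] := outside_finite fG; split.
- move=> sigma stau; split; first exact: loops_of_loop_configuration.
  exact: loops_of_agree_off.
- move=> s s' /set_mem stau /set_mem s'tau E; apply/funext => u.
  suff : s u (+) s' u = s u0 (+) s' u0.
    by rewrite (stau u0) // (s'tau u0) // addbb; case: (s u) (s' u) => [] [].
  apply: (tadj_connected (f := fun u => s u (+) s' u)) => {}u v uv.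
  have := loops_of_dual s uv; rewrite E => H.
  have : (s u != s v) = (s' u != s' v).
    by apply/idP/idP => [/H/(loops_of_dual _ uv)|/(loops_of_dual s' uv)/H].
  by case: (s u) (s v) (s' u) (s' v) => [] [] [] [].
- move=> omega [loopo oE]; have [rho rhoE] := loop_configuration_loops_of loopo.
  (* Across every edge between two hexagons outside [G], [rho] and [tau] change together. By
     connectedness they differ there by a constant, read off at [u0]. *)
  pose c := rho u0 (+) tau u0; pose sigma : spin_config := fun u => rho u (+) c.
  have sE : loops_of sigma = omega.
    rewrite -rhoE; apply/seteqP; split=> e [eH [u [v [eu ev suv]]]]; split=> //;
    by exists u, v; split=> //; move: suv; rewrite /sigma; case: (rho u) (rho v) (c) => [] [] [].
  exists sigma => // u Gu.
  have [p [up vE pG]] := GC u0 u Gu0 Gu.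
  suff : rho u (+) tau u = c by rewrite /sigma => <-; case: (rho u) (tau u) => [] [].
  rewrite -vE /c; elim: p (u0) Gu0 up pG {vE GC sE c sigma} => //= v p IHp w Gw /andP[wv vp] pG.
  have Gv : ~ G v by apply: pG; rewrite !inE eqxx orbT.
  rewrite IHp // => [|z zp]; last by apply: pG; rewrite inE zp orbT.
  have : (rho w != rho v) = (tau w != tau v).
    have eG : ~ bordering_edges G (dual w v).
      by move=> [_ [z Gz /(borders_dual _ wv)[]zE]]; subst z.
    have /seteqP[sub sub'] := oE.
    apply/idP/idP => [/(loops_of_dual _ wv)|/(loops_of_dual _ wv)] H.
      apply/(loops_of_dual _ wv); apply: (sub (dual w v) _).1.
      by rewrite -rhoE; split.
    apply/(loops_of_dual _ wv); rewrite rhoE; apply: (sub' (dual w v) _).1.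
    by split.
  by case: (rho w) (rho v) (tau w) (tau v) => [] [] [] [].
Qed.

(** The bijection sends an edge to the pair of hexagons that it separates. *)
Lemma num_edges_loops_of G sigma : finite_set G ->
  num_edges (bordering_edges G) (loops_of sigma) = spin_e G sigma.
Proof.
move=> fG; set S := loops_of sigma `&` bordering_edges G.
have fS : finite_set S by apply: finite_setIr; exact: bordering_edges_finite.
pose h (e : fset_set S) : {fset hexagon} := fset_set [set w | borders (val e) w].
have SP (e : fset_set S) : S (val e) by have := valP e; rewrite in_fset_set ?inE.
have hE (e : fset_set S) u v : tadj u v -> val e = dual u v -> h e = [fset u; v]%fset.
  move=> uv eE; rewrite /h; apply/fsetP => w.
  have -> : [set w | borders (val e) w] = [set` [fset u; v]%fset].
    rewrite eE; apply/seteqP; split=> z /=; rewrite !inE.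
      by move=> /(borders_dual _ uv)[]->; rewrite eqxx ?orbT.
    by move=> zuv; apply/(borders_dual _ uv); case/orP: zuv => /eqP->; [left | right].
  by rewrite set_fsetK.
symmetry; rewrite /num_edges -/S /Defs.card.
rewrite [RHS]cardfE; apply: (card_bij (P := predT) (h := h) _ _ _).2.
- move=> e _; have [es [_ [w Gw ew]]] := SP e.
  have [u [v [uv eE]]] := graph_edges_dual es.1.
  have suv : sigma u != sigma v by apply/(loops_of_dual _ uv); rewrite -eE.
  rewrite /= (hE e u v uv eE); split; first by exists u, v.
  move: ew; rewrite eE => /(borders_dual _ uv)[] wE; subst w.
    by exists u, v; rewrite !inE !eqxx orbT.
  by exists v, u; split; rewrite ?inE ?eqxx ?orbT // eq_sym.
- move=> e e' _ _; have [[eH _] _] := SP e; have [[e'H _] _] := SP e'.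
  have [u [v [uv eE]]] := graph_edges_dual eH.
  have [u' [v' [uv' e'E]]] := graph_edges_dual e'H.
  rewrite (hE e u v) // (hE e' u' v') // => /fsetP E; apply: val_inj.
  rewrite eE e'E.
  have nuv : u != v by move: uv; rewrite tadjE => /andP[].
  have := (E u, E v); rewrite !inE !eqxx orbT /= => -[/esym/orP[]/eqP uE /esym/orP[]/eqP vE];
    subst u v; rewrite ?eqxx // in nuv *.
  exact: dualC.
- move=> e [[a [b [ab eE]]] [u [v [ue ve Gu suv]]]].
  have nab : a != b by move: ab; rewrite tadjE => /andP[].
  have sab : sigma a != sigma b.
    move: ue ve suv; rewrite eE !inE => /orP[]/eqP-> /orP[]/eqP->; rewrite ?eqxx //.
    by rewrite eq_sym.
  have Se : S (dual a b).
    split; first exact/(loops_of_dual _ ab).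
    split; first exact: dual_edge.
    exists u => //; apply/(borders_dual _ ab).
    by move: ue; rewrite eE !inE => /orP[]/eqP; [left | right].
  have ef : dual a b \in fset_set S by rewrite in_fset_set ?inE.
  by exists [` ef]%fset => //; rewrite (hE _ a b) // eE.
Qed.

(** * Transport of weighted laws *)

(** The factor [c] multiplies both the partial sum and the normalizing sum, and cancels in the
    quotient. *)
Lemma weighted_law_bij (R : realType) (T U : choiceType) (S : set T) (S' : set U)
    (w : T -> R) (w' : U -> R) (h : T -> U) (c : R) (B : set U) :
  set_bij S S' h -> c != 0 -> (forall t, S t -> w t = c * w' (h t)) ->
  weighted_law S w (h @^-1` B) = weighted_law S' w' B.
Proof.
move=> hbij c0 wE.
have sumE A : \sum_(t \in S `&` h @^-1` A) w t = c * \sum_(u \in S' `&` A) w' u.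
  rewrite (reindex_fsbig h (S `&` h @^-1` A)).
    rewrite mulr_fsumr; apply: eq_fsbigr => t /set_mem[St _]; exact: wE.
  have [hS hinj hsurj] := hbij; split.
  - by move=> t [/hS].
  - by move=> t t' /set_mem[/mem_set St _] /set_mem[/mem_set St' _]; exact: hinj.
  - by move=> u [/hsurj[t St <-] Au]; exists t.
rewrite /weighted_law sumE; congr (_%:E).
by have := sumE setT; rewrite preimage_setT !setIT => ->; rewrite -mulf_div divff ?mul1r.
Qed.

Lemma spin_law_loops_of (R : realType) G tau (n x : R) (B : set subgraph) :
  finite_set G -> connected_set (~` G) -> 0 < n ->
  spin_measure G n x tau (loops_of @^-1` B) =
  loop_measure (bordering_edges G) n x (loops_of tau) B.
Proof.
move=> fG GC n0; have n_neq0 : n != 0 by rewrite gt_eqF.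
pose l sigma := num_loops (bordering_edges G) (loops_of sigma).
(* The exponent is k - l evaluated at [tau], which agrees with every admissible [sigma] off [G]. *)
apply: (@weighted_law_bij _ _ _ _ _ _ _ _ (n ^ (spin_k G tau - (l tau)%:Z))).
- exact: loops_of_bij.
- exact: expfz_neq0.
move=> sigma stau; rewrite num_edges_loops_of //.
rewrite -[spin_k G sigma](subrK (l sigma)%:Z) expfzDr //.
by rewrite (spin_k_sub_num_loops fG stau) -mulrA [X in _ * X]mulrC.
Qed.

Theorem proposition3 (R : realType) (G : set hexagon) (tau : spin_config)
  (n x : R)
  (G_finite : finite_set G)
  (GC_connected : connected_set (~` G))
  (n_gt0 : 0 < n) (x_gt0 : 0 < x)
  (d : measure_display) (T : measurableType d) (P : probability T R)
  (sigma : {RV P >-> spin_config})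
  (sigma_law : distribution P sigma = spin_measure G n x tau :> (_ -> _)) :
  pushforward P (loops_of \o sigma) =
  loop_measure (bordering_edges G) n x (loops_of tau).
Proof.
apply/funext => B; rewrite -spin_law_loops_of // -sigma_law.
(* By unfolding, the law of the composition at [B] is the law of [sigma] at the preimage of [B]
   under [loops_of]. *)
by [].
Qed.
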